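(* Let $\alpha,\beta,\gamma,\mu,\nu,\kappa,D$ be real constants with $\nu$ and $\mu D^2$ not both zero, and consider the fourth-order ordinary differential equation for $H=H(z)$ $$(\nu H+\mu D^{2})H^{(4)}+\alpha H'H'''+\beta (H'')^{2}+(2\gamma H+\kappa-D^{2})H''+2\gamma (H')^{2}=0,\qquad ( * )$$ on the region of the $(z,H)$-plane where $\nu H+\mu D^2\neq 0$. Then: (1) If $\nu=0$, then $( * )$ is linearizable if and only if $\alpha=\beta=\gamma=0$. (2) If $\nu\neq0$, $\gamma=0$ and $\beta=0$, then $( * )$ is linearizable if and only if $\alpha=0$ and $\kappa=D^2$. (3) If $\nu\neq0$, $\gamma=0$ and $\beta=3\nu$, then $( * )$ is linearizable if and only if $\alpha=4\nu$ and $\kappa=D^2$. (4) If $\nu\neq0$ and $\gamma\neq0$, then $( * )$ is linearizable if and only if $\alpha=4\nu$, $\beta=3\nu$ and $\kappa=\dfrac{(2\gamma\mu+\nu)D^2}{\nu}$.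
   Context: Equation $( * )$ is the equation satisfied by the profile $H$ of travelling wave solutions $u(x,t)=H(x-Dt)$ of the partial differential equation $u_{tt}=(\kappa u+\gamma u^2)_{xx}+\nu u u_{xxxx}+\mu u_{xxtt}+\alpha u_xu_{xxx}+\beta u_{xx}^2$. A fourth-order ordinary differential equation for $H(z)$ is called linearizable if (locally, near every point of the region of the $(z,H)$-plane under consideration) there is a point transformation, i.e. a smooth change of variables $\tilde t=\varphi(z,H)$, $\tilde u=\psi(z,H)$ with nonvanishing Jacobian, which maps the equation to a linear equation of the form $$\tilde u^{(4)}+a(\tilde t)\,\tilde u'+b(\tilde t)\,\tilde u=0$$ for some functions $a,b$ of $\tilde t$, where primes denote derivatives with respect to $\tilde t$. *)

(* Defs.v *)
From Stdlib Require Import Reals Lra Lia.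
From Coquelicot Require Import Coquelicot.
Open Scope R_scope.

(** [E z h0 h1 h2 h3 h4] is the equation at the point [z], where [hk] stands for
    the value of the k-th derivative of the unknown function. *)
Definition ode4 := R -> R -> R -> R -> R -> R -> Prop.

Definition holds_at (E : ode4) (f : R -> R) (z : R) : Prop :=
  E z (f z) (Derive_n f 1 z) (Derive_n f 2 z) (Derive_n f 3 z) (Derive_n f 4 z).

Definition linear4 (a b : R -> R) : ode4 :=
  fun t u0 u1 u2 u3 u4 => u4 + a t * u1 + b t * u0 = 0.

(** C-infinity on a set of the plane (meant for open sets): all iterated partial
    derivatives, in any order, exist and are jointly continuous. *)
Definition smooth_on (U : R * R -> Prop) (f : R -> R -> R) : Prop :=
  forall x y : R, U (x, y) -> forall n : nat, ex_diff_n f n x y.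

Definition jacobian (phi psi : R -> R -> R) (x y : R) : R :=
  Derive (fun s => phi s y) x * Derive (fun s => psi x s) y
  - Derive (fun s => phi x s) y * Derive (fun s => psi s y) x.

Definition point_transformation (U : R * R -> Prop) (phi psi : R -> R -> R) : Prop :=
  smooth_on U phi /\ smooth_on U psi /\
  forall x y : R, U (x, y) -> jacobian phi psi x y <> 0.

(** Let [H] be a four times differentiable function whose graph lies in [U] and
    is mapped by [(phi, psi)] to a curve on which the new independent variable
    [phi] has nonvanishing derivative, so that the image curve is again a graph
    [u~ = u(t~)]; the values of [u] on the image determine all its derivatives
    there.  Writing the equation [E] for [H] in the new variables amounts to the
    equation [F] for [u], at corresponding points.  As [H] is not assumed to be
    a solution, this is a statement about the equations themselves; it implies
    that solutions of [E] and of [F] correspond to each other. *)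
Definition maps_equation (U : R * R -> Prop) (phi psi : R -> R -> R)
    (E F : ode4) : Prop :=
  forall (c d : R) (H u : R -> R),
    (forall z, c < z < d -> forall k : nat, (k <= 4)%nat -> ex_derive_n H k z) ->
    (forall z, c < z < d -> U (z, H z)) ->
    (forall z, c < z < d -> Derive (fun s => phi s (H s)) z <> 0) ->
    (forall z, c < z < d -> u (phi z (H z)) = psi z (H z)) ->
    forall z, c < z < d -> (holds_at E H z <-> holds_at F u (phi z (H z))).

(** Linearizability near every point of the region [Omega]; the transformation
    and the coefficients [a], [b] may depend on the point. *)
Definition linearizable (Omega : R * R -> Prop) (E : ode4) : Prop :=
  forall p : R * R, Omega p ->
    exists (U : R * R -> Prop) (phi psi : R -> R -> R) (a b : R -> R),
      open U /\ U p /\ (forall q, U q -> Omega q) /\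
      point_transformation U phi psi /\
      maps_equation U phi psi E (linear4 a b).

Definition profile_equation (alpha beta gamma mu nu kappa D : R) : ode4 :=
  fun _ h0 h1 h2 h3 h4 =>
    (nu * h0 + mu * D ^ 2) * h4 + alpha * h1 * h3 + beta * h2 ^ 2
    + (2 * gamma * h0 + kappa - D ^ 2) * h2 + 2 * gamma * h1 ^ 2 = 0.

Definition profile_region (mu nu D : R) : R * R -> Prop :=
  fun p => nu * snd p + mu * D ^ 2 <> 0.

(* Main.v *)
Require Import Defs.
From Stdlib Require Import Reals Lra Lia ClassicalEpsilon FunctionalExtensionality.
From Coquelicot Require Import Coquelicot.
Open Scope R_scope.

(** In the new variables [u''''] contains [h2 h3] (where [hk] is the [k]-th derivative of [H])
    with the coefficient [-10 phi_H J / (D phi)^6], [J] being the Jacobian; as the profile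
    equation has no such term, [phi_H = 0].  Then [u'''' + a u' + b u] is a linear operator
    [G'''' + A G''' + B G'' + C G' + E G], with coefficients depending on [z] only, applied to
    [G(z) = psi(z, H(z))].  Write [W = nu H + mu D^2] and [m = 2 gamma H + kappa - D^2].
    Comparing the coefficients of [h1 h3], [h2^2], [h1^2 h2], [h3], [h2] and [h1^2] gives
    [4 W psi_HH = alpha psi_H], [3 W psi_HH = beta psi_H], [psi_HHH = 0],
    [4 psi_zH + A psi_H = 0], [W (6 psi_zzH + 3 A psi_zH + B psi_H) = m psi_H] and
    [W (6 psi_zzHH + 3 A psi_zHH + B psi_HH) = 2 gamma psi_H].  The first three force
    [3 alpha = 4 beta] and [alpha (alpha - 4 nu) = 0]; the next two say that [m / W] depends on
    [z] only, hence is constant, and the last one that [gamma (alpha - 4 nu) = 0].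

    Conversely, under the conditions found, the equation is, up to a nonzero factor, [G'''' + 10 q G'' = 0] with [G = H]
    or [G = W^2] and [q] constant.  If [theta] and [theta2] are independent solutions of
    [theta'' + q theta = 0], the change [t = theta2 / theta], [u = G / theta^3] removes the
    second-order term. *)

(** * Chains of successive derivatives on an interval *)

(** Successive derivatives are supplied as explicit functions instead of [Derive_n], so that closed
    formulas can be verified one differentiation at a time. *)
Definition tower (c d : R) (n : nat) (T : nat -> R -> R) : Prop :=
  forall k, (k < n)%nat -> forall s, c < s < d -> is_derive (T k) s (T (S k) s).

Lemma locally_of_interval (c d s : R) (P : R -> Prop) :
  c < s < d -> (forall x, c < x < d -> P x) -> locally s P.
Proof.
  intros Hs HP.
  assert (He : 0 < Rmin (s - c) (d - s)) by (apply Rmin_pos; lra).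
  exists (mkposreal _ He); intros y Hy.
  unfold ball in Hy; simpl in Hy; unfold AbsRing_ball, minus, plus, opp, abs in Hy; simpl in Hy.
  pose proof (Rmin_l (s - c) (d - s)); pose proof (Rmin_r (s - c) (d - s)).
  apply HP; apply Rabs_def2 in Hy; lra.
Qed.

Lemma tower_Derive_n (c d : R) (n : nat) (T : nat -> R -> R) (f : R -> R) :
  (forall s, c < s < d -> f s = T 0%nat s) -> tower c d n T ->
  forall k, (k <= n)%nat -> forall s, c < s < d -> Derive_n f k s = T k s.
Proof.
  intros Hf HT k; induction k as [|k IH]; intros Hk s Hs.
  - exact (Hf s Hs).
  - simpl; transitivity (Derive (T k) s).
    + apply Derive_ext_loc, (locally_of_interval c d); [exact Hs|].
      intros x Hx; apply IH; [lia | exact Hx].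
    + apply is_derive_unique, HT; [lia | exact Hs].
Qed.

Lemma tower_ex_derive_n (c d : R) (n : nat) (T : nat -> R -> R) (f : R -> R) :
  (forall s, c < s < d -> f s = T 0%nat s) -> tower c d n T ->
  forall k, (k <= n)%nat -> forall s, c < s < d -> ex_derive_n f k s.
Proof.
  intros Hf HT [|k] Hk s Hs; [exact I|].
  simpl; apply ex_derive_ext_loc with (T k).
  - apply (locally_of_interval c d); [exact Hs|].
    intros x Hx; symmetry; apply (tower_Derive_n c d n); auto; lia.
  - exists (T (S k) s); apply HT; [lia | exact Hs].
Qed.

Lemma tower_of_ex_derive_n (c d : R) (n : nat) (f : R -> R) :
  (forall s, c < s < d -> forall k, (k <= n)%nat -> ex_derive_n f k s) ->
  tower c d n (Derive_n f).
Proof.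
  intros H k Hk s Hs; simpl; apply Derive_correct.
  exact (H s Hs (S k) Hk).
Qed.

(** * Derivatives of a function given parametrically *)

(* [Phi] is continuous near [z] and crosses the value [Phi z] there, so by the
   intermediate value theorem every argument of [u] close to [Phi z] is attained
   close to [z]. *)
Lemma is_derive_parametric_pos (Phi Psi u : R -> R) (c d z p q : R) :
  c < z < d -> (forall s, c < s < d -> continuity_pt Phi s) ->
  (forall s, c < s < d -> u (Phi s) = Psi s) ->
  is_derive Phi z p -> is_derive Psi z q -> 0 < p ->
  is_derive u (Phi z) (q / p).
Proof.
  intros Hz HC Hu HPhi HPsi Hp.
  apply is_derive_Reals in HPhi; apply is_derive_Reals in HPsi; apply is_derive_Reals.
  intros eps Heps.
  assert (He1 : 0 < p / 2) by lra.
  destruct (HPhi _ He1) as [d1 Hd1].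
  (* The error of the difference quotient will be [(y - q / p * x) / (p + x)]: its numerator stays
     below [2 * e2 = eps * p / 4] and its denominator above [p / 2]. The [+ 1] in [q'] below keeps
     [e3] well defined when [q = 0]. *)
  set (e2 := eps * p / 2 / 4).
  assert (He2 : 0 < e2) by (unfold e2; nra).
  destruct (HPsi _ He2) as [d2 Hd2].
  set (q' := Rabs q / p + 1).
  assert (Hq' : 0 < q') by (unfold q'; pose proof (Rabs_pos q);
    assert (0 <= Rabs q / p) by (apply Rdiv_le_0_compat; lra); lra).
  set (e3 := e2 / q').
  assert (He3 : 0 < e3) by (apply Rdiv_lt_0_compat; lra).
  destruct (HPhi _ He3) as [d3 Hd3].
  set (dl := Rmin (Rmin d1 d2) (Rmin d3 (Rmin (z - c) (d - z))) / 2).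
  assert (Hdl : 0 < dl /\ dl < d1 /\ dl < d2 /\ dl < d3 /\ dl < z - c /\ dl < d - z).
  { pose proof (cond_pos d1); pose proof (cond_pos d2); pose proof (cond_pos d3).
    unfold dl, Rmin; repeat destruct Rle_dec; lra. }
  destruct Hdl as (Hdl0 & Hl1 & Hl2 & Hl3 & Hl4 & Hl5).
  assert (Hinc : forall h, h <> 0 -> Rabs h <= dl ->
    exists x y, Phi (z + h) - Phi z = (p + x) * h /\ Psi (z + h) - Psi z = (q + y) * h
      /\ Rabs x < p / 2 /\ Rabs x < e3 /\ Rabs y < e2).
  { intros h Hh Hle.
    exists ((Phi (z + h) - Phi z) / h - p), ((Psi (z + h) - Psi z) / h - q).
    repeat split; try (field; exact Hh).
    - apply Hd1; [exact Hh | lra].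
    - apply Hd3; [exact Hh | lra].
    - apply Hd2; [exact Hh | lra]. }
  assert (Hup : Phi z < Phi (z + dl)).
  { destruct (Hinc dl) as (x & y & E & _ & Hx & _); [lra | rewrite Rabs_pos_eq; lra |].
    apply Rabs_def2 in Hx; nra. }
  assert (Hlo : Phi (z - dl) < Phi z).
  { destruct (Hinc (- dl)) as (x & y & E & _ & Hx & _);
      [lra | rewrite Rabs_Ropp, Rabs_pos_eq; lra |].
    unfold Rminus in *; apply Rabs_def2 in Hx; nra. }
  assert (Hr : 0 < Rmin (Phi (z + dl) - Phi z) (Phi z - Phi (z - dl)))
    by (apply Rmin_pos; lra).
  exists (mkposreal _ Hr); intros k Hk Hkr; simpl in Hkr.
  pose proof (Rmin_l (Phi (z + dl) - Phi z) (Phi z - Phi (z - dl))).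
  pose proof (Rmin_r (Phi (z + dl) - Phi z) (Phi z - Phi (z - dl))).
  assert (Hkr' := Hkr); apply Rabs_def2 in Hkr'.
  destruct (Ranalysis5.f_interv_is_interv Phi (z - dl) (z + dl) (Phi z + k)) as [s [Hs Es]];
    [lra | lra | intros x Hx; apply HC; lra |].
  assert (Hsz : s - z <> 0).
  { intros E; replace s with z in Es by lra; lra. }
  rewrite <- Es, !Hu by lra.
  destruct (Hinc (s - z)) as (x & y & E1 & E2 & Hx & Hx3 & Hy);
    [exact Hsz | apply Rabs_le; lra |].
  replace (z + (s - z)) with s in * by ring.
  assert (Hk2 : k = (p + x) * (s - z)) by lra.
  assert (Hpx : p / 2 < p + x) by (apply Rabs_def2 in Hx; lra).
  rewrite E2, Hk2.
  replace ((q + y) * (s - z) / ((p + x) * (s - z)) - q / p)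
    with ((y - q / p * x) / (p + x)) by (field; repeat split; lra).
  unfold Rdiv at 1; rewrite Rabs_mult, Rabs_inv, (Rabs_pos_eq (p + x)) by lra.
  apply Rmult_lt_reg_r with (p + x); [lra|].
  rewrite Rmult_assoc, Rinv_l, Rmult_1_r by lra.
  assert (Hq : Rabs (q / p * x) <= e2).
  { unfold Rdiv; rewrite 2!Rabs_mult, Rabs_inv, (Rabs_pos_eq p) by lra.
    fold (Rabs q / p). apply Rle_trans with (q' * e3).
    - apply Rmult_le_compat; try apply Rabs_pos; [| unfold q'; lra | lra].
      apply Rdiv_le_0_compat; [apply Rabs_pos | lra].
    - unfold e3; right; field; lra. }
  assert (Hy2 : Rabs (y - q / p * x) <= Rabs y + Rabs (q / p * x)).
  { unfold Rminus; eapply Rle_trans; [apply Rabs_triang | rewrite Rabs_Ropp; lra]. }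
  assert (eps * (p / 2) < eps * (p + x)) by (apply Rmult_lt_compat_l; lra).
  unfold e2 in *; nra.
Qed.

(** A negative [p] is reduced to the positive case by reflection: [u (- t)] is parametrized by
    [- Phi]. *)
Lemma is_derive_parametric (Phi Psi u : R -> R) (c d z p q : R) :
  c < z < d -> (forall s, c < s < d -> continuity_pt Phi s) ->
  (forall s, c < s < d -> u (Phi s) = Psi s) ->
  is_derive Phi z p -> is_derive Psi z q -> p <> 0 ->
  is_derive u (Phi z) (q / p).
Proof.
  intros Hz HC Hu HPhi HPsi Hp.
  destruct (Rlt_dec 0 p) as [Hpos|Hneg];
    [apply (is_derive_parametric_pos Phi Psi u c d); auto|].
  assert (H : is_derive (fun t => u (- t)) (- Phi z) (q / - p)).
  { apply (is_derive_parametric_pos (fun s => - Phi s) Psi _ c d); auto; [| | |lra].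
    - intros s Hs; apply continuity_pt_opp, HC, Hs.
    - intros s Hs; rewrite Ropp_involutive; auto.
    - apply (is_derive_opp Phi); exact HPhi. }
  apply is_derive_ext with (fun t => u (- - t)); [intros t; now rewrite Ropp_involutive|].
  replace (q / p) with (- 1 * (q / - p)) by (field; exact Hp).
  apply (is_derive_comp (fun t => u (- t)) (fun t => - t)); [exact H|].
  auto_derive; [exact I | ring].
Qed.

Lemma tower_continuity (c d : R) (n : nat) (T : nat -> R -> R) :
  (0 < n)%nat -> tower c d n T -> forall s, c < s < d -> continuity_pt (T 0%nat) s.
Proof.
  intros Hn HT s Hs; apply continuity_pt_filterlim, (ex_derive_continuous (T 0%nat)).
  exists (T 1%nat s); apply HT; [exact Hn | exact Hs].
Qed.

(* The derivatives of [u] with respect to the new variable [t = Phi z], obtained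
   by solving the Faa di Bruno relations for [u (Phi z) = Psi z]. *)
Definition u1 (f g : nat -> R) : R := g 1%nat / f 1%nat.
Definition u2 (f g : nat -> R) : R := (g 2%nat - u1 f g * f 2%nat) / f 1%nat ^ 2.
Definition u3 (f g : nat -> R) : R :=
  (g 3%nat - 3 * u2 f g * f 1%nat * f 2%nat - u1 f g * f 3%nat) / f 1%nat ^ 3.
Definition u4 (f g : nat -> R) : R :=
  (g 4%nat - 6 * u3 f g * f 1%nat ^ 2 * f 2%nat
   - u2 f g * (4 * f 1%nat * f 3%nat + 3 * f 2%nat ^ 2) - u1 f g * f 4%nat) / f 1%nat ^ 4.

Lemma Derive_n_parametric (Phi Psi : nat -> R -> R) (u : R -> R) (c d : R) :
  tower c d 4 Phi -> tower c d 4 Psi ->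
  (forall s, c < s < d -> Phi 1%nat s <> 0) ->
  (forall s, c < s < d -> u (Phi 0%nat s) = Psi 0%nat s) ->
  forall s, c < s < d ->
    Derive_n u 1 (Phi 0%nat s) = u1 (fun k => Phi k s) (fun k => Psi k s) /\
    Derive_n u 4 (Phi 0%nat s) = u4 (fun k => Phi k s) (fun k => Psi k s).
Proof.
  intros HPhi HPsi Hne Hu.
  pose proof (tower_continuity c d 4 Phi (Nat.lt_0_succ 3) HPhi) as HC.
  (* One differentiation in the new variable is a differentiation along the curve followed by
     division by [Phi']. Below it is iterated, the derivative of [u_k] along the curve being
     [Phi' * u_(k+1)]. *)
  assert (step : forall v V V', (forall s, c < s < d -> v (Phi 0%nat s) = V s) ->
    (forall s, c < s < d -> is_derive V s (V' s)) ->
    forall s, c < s < d -> Derive v (Phi 0%nat s) = V' s / Phi 1%nat s).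
  { intros v V V' Hv HV s Hs; apply is_derive_unique.
    apply (is_derive_parametric (Phi 0%nat) V v c d); auto.
    apply HPhi; [lia | exact Hs]. }
  assert (HD : forall k, (k < 4)%nat -> forall s, c < s < d ->
    ex_derive (fun x => Phi k x) s /\ Derive (fun x => Phi k x) s = Phi (S k) s).
  { intros k Hk s Hs; specialize (HPhi k Hk s Hs); split; [now exists (Phi (S k) s)|].
    now apply is_derive_unique. }
  assert (HE : forall k, (k < 4)%nat -> forall s, c < s < d ->
    ex_derive (fun x => Psi k x) s /\ Derive (fun x => Psi k x) s = Psi (S k) s).
  { intros k Hk s Hs; specialize (HPsi k Hk s Hs); split; [now exists (Psi (S k) s)|].
    now apply is_derive_unique. }
  assert (H1 : forall s, c < s < d ->
    Derive_n u 1 (Phi 0%nat s) = u1 (fun k => Phi k s) (fun k => Psi k s)).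
  { intros s Hs; simpl; rewrite (step u (Psi 0%nat) (Psi 1%nat)); auto; intros x Hx; apply HPsi; auto; lia. }
  assert (H2 : forall s, c < s < d ->
    Derive_n u 2 (Phi 0%nat s) = u2 (fun k => Phi k s) (fun k => Psi k s)).
  { intros s Hs.
    change (Derive_n u 2) with (Derive (Derive_n u 1)).
    rewrite (step _ _ (fun s => (Psi 2%nat s - u1 (fun k => Phi k s) (fun k => Psi k s) * Phi 2%nat s)
        / Phi 1%nat s) H1); [unfold u2, u1; field; auto | | exact Hs].
    intros x Hx; unfold u1; auto_derive.
    - destruct (HD 1%nat) with (2:=Hx) as [? _]; [lia|].
      destruct (HE 1%nat) with (2:=Hx) as [? _]; [lia|]. auto.
    - destruct (HD 1%nat) with (2:=Hx) as [_ ->]; [lia|].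
      destruct (HE 1%nat) with (2:=Hx) as [_ ->]; [lia|]. field; auto. }
  assert (H3 : forall s, c < s < d ->
    Derive_n u 3 (Phi 0%nat s) = u3 (fun k => Phi k s) (fun k => Psi k s)).
  { intros s Hs.
    change (Derive_n u 3) with (Derive (Derive_n u 2)).
    rewrite (step _ _ (fun s => Phi 1%nat s * u3 (fun k => Phi k s) (fun k => Psi k s)) H2);
      [field; auto | | exact Hs].
    intros x Hx; unfold u3, u2, u1.
    destruct (HD 1%nat) with (2:=Hx) as [? E1]; [lia|].
    destruct (HE 1%nat) with (2:=Hx) as [? E2]; [lia|].
    destruct (HD 2%nat) with (2:=Hx) as [? E3]; [lia|].
    destruct (HE 2%nat) with (2:=Hx) as [? E4]; [lia|].
    specialize (Hne x Hx).
    auto_derive.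
    - repeat split; auto; apply (pow_nonzero (Phi 1%nat x) 2), Hne.
    - rewrite E1, E2, E3, E4; field; auto. }
  intros s Hs; split; [exact (H1 s Hs)|].
  change (Derive_n u 4) with (Derive (Derive_n u 3)).
  rewrite (step _ _ (fun s => Phi 1%nat s * u4 (fun k => Phi k s) (fun k => Psi k s)) H3);
      [field; auto | | exact Hs].
  intros x Hx; unfold u4, u3, u2, u1.
  destruct (HD 1%nat) with (2:=Hx) as [? E1]; [lia|].
  destruct (HE 1%nat) with (2:=Hx) as [? E2]; [lia|].
  destruct (HD 2%nat) with (2:=Hx) as [? E3]; [lia|].
  destruct (HE 2%nat) with (2:=Hx) as [? E4]; [lia|].
  destruct (HD 3%nat) with (2:=Hx) as [? E5]; [lia|].
  destruct (HE 3%nat) with (2:=Hx) as [? E6]; [lia|].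
  specialize (Hne x Hx).
  auto_derive.
  - repeat split; auto; apply (pow_nonzero (Phi 1%nat x) 3), Hne.
  - rewrite E1, E2, E3, E4, E5, E6; field; auto.
Qed.

(** * Total derivatives along a curve *)

Lemma interval_of_locally (z : R) (P : R -> Prop) :
  locally z P -> exists e, 0 < e /\ forall s, z - e < s < z + e -> P s.
Proof.
  intros [e He]; exists e; split; [apply cond_pos|].
  intros s Hs; apply He; change (Rabs (s - z) < e); apply Rabs_def1; lra.
Qed.

Lemma open_locally_2d (U : R * R -> Prop) (x y : R) :
  open U -> U (x, y) -> locally_2d (fun a b => U (a, b)) x y.
Proof.
  intros HU Hxy; apply locally_2d_locally.
  apply (filter_imp U); [now intros [a b] | exact (HU (x, y) Hxy)].
Qed.

Lemma smooth_partial_derive (U : R * R -> Prop) (f : R -> R -> R) (i j : nat) :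
  smooth_on U f -> smooth_on U (partial_derive i j f).
Proof.
  intros Hf x y Hxy n.
  replace n with ((n + (i + j)) - (i + j))%nat by lia.
  apply ex_diff_n_deriv; [lia | auto].
Qed.

(** [partial_derive i j] differentiates in the second variable first, so raising [j] requires
    exchanging mixed partials, which uses smoothness on a whole neighbourhood and hence the openness
    of [U]. *)
Lemma is_derive_snd_partial (U : R * R -> Prop) (f : R -> R -> R) (i j : nat) (x y : R) :
  open U -> smooth_on U f -> U (x, y) ->
  is_derive (fun v => partial_derive i j f x v) y (partial_derive i (S j) f x y).
Proof.
  intros HU Hf Hxy.
  rewrite <- Derive_partial_derive.
  - apply Derive_correct.
    exact (proj1 (proj2 (proj2 (smooth_partial_derive U f i j Hf x y Hxy 1%nat)))).
  - apply locally_2d_impl with (2 := open_locally_2d U x y HU Hxy).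
    apply locally_2d_forall; intros u v Huv; apply Hf, Huv.
Qed.

Lemma is_derive_fst_partial (U : R * R -> Prop) (f : R -> R -> R) (i j : nat) (x y : R) :
  smooth_on U f -> U (x, y) ->
  is_derive (fun v => partial_derive i j f v y) x (partial_derive (S i) j f x y).
Proof.
  intros Hf Hxy.
  apply (Derive_correct (fun v => partial_derive i j f v y)).
  exact (proj1 (proj2 (smooth_partial_derive U f i j Hf x y Hxy 1%nat))).
Qed.

(** This is the chain rule along [s -> (s, H s)]. Differentiability in two variables follows from a
    first partial that exists nearby and is continuous at the point, together with the existence of
    the second one. *)
Lemma is_derive_partial_along (U : R * R -> Prop) (f : R -> R -> R) (i j : nat)
    (H : R -> R) (z h1 : R) :
  open U -> smooth_on U f -> U (z, H z) -> is_derive H z h1 ->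
  is_derive (fun s => partial_derive i j f s (H s)) z
    (partial_derive (S i) j f z (H z) + partial_derive i (S j) f z (H z) * h1).
Proof.
  intros HU Hf Hz HH.
  assert (HD : differentiable_pt_lim (partial_derive i j f) z (H z)
    (partial_derive (S i) j f z (H z)) (partial_derive i (S j) f z (H z))).
  { apply filterdiff_differentiable_pt_lim.
    apply (is_derive_filterdiff (partial_derive i j f) z (H z) (partial_derive (S i) j f)).
    - apply (filter_imp U); [|exact (HU _ Hz)].
      intros [u v] Huv; exact (is_derive_fst_partial U f i j u v Hf Huv).
    - exact (is_derive_snd_partial U f i j z (H z) HU Hf Hz).
    - apply continuity_2d_pt_filterlim.
      exact (proj1 (smooth_partial_derive U f (S i) j Hf z (H z) Hz 0%nat)). }
  apply is_derive_Reals.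
  rewrite <- (Rmult_1_r (partial_derive (S i) j f z (H z))).
  apply (derivable_pt_lim_comp_2d _ (fun s => s) H); [exact HD | apply derivable_pt_lim_id |].
  now apply is_derive_Reals.
Qed.

(* [p i j] stands for the value of the mixed partial derivative of order [(i, j)]
   of a function of [(z, H)], and [h k] for that of the k-th derivative of [H]. *)
Definition total_derivative (p : nat -> nat -> R) (h : nat -> R) (k : nat) : R :=
  match k with
  | 0%nat => p 0%nat 0%nat
  | 1%nat => p 1%nat 0%nat + p 0%nat 1%nat * h 1%nat
  | 2%nat => p 2%nat 0%nat + 2 * p 1%nat 1%nat * h 1%nat + p 0%nat 2%nat * h 1%nat ^ 2
      + p 0%nat 1%nat * h 2%nat
  | 3%nat => p 3%nat 0%nat + 3 * p 2%nat 1%nat * h 1%nat + 3 * p 1%nat 2%nat * h 1%nat ^ 2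
         + p 0%nat 3%nat * h 1%nat ^ 3
         + 3 * p 1%nat 1%nat * h 2%nat + 3 * p 0%nat 2%nat * h 1%nat * h 2%nat + p 0%nat 1%nat * h 3%nat
  | _ => p 4%nat 0%nat + 4 * p 3%nat 1%nat * h 1%nat + 6 * p 2%nat 2%nat * h 1%nat ^ 2
         + 4 * p 1%nat 3%nat * h 1%nat ^ 3
         + p 0%nat 4%nat * h 1%nat ^ 4 + 6 * p 2%nat 1%nat * h 2%nat + 12 * p 1%nat 2%nat * h 1%nat * h 2%nat
         + 6 * p 0%nat 3%nat * h 1%nat ^ 2 * h 2%nat + 3 * p 0%nat 2%nat * h 2%nat ^ 2
         + 4 * p 1%nat 1%nat * h 3%nat + 4 * p 0%nat 2%nat * h 1%nat * h 3%nat + p 0%nat 1%nat * h 4%nat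
  end.

Definition partials (f : R -> R -> R) (x y : R) : nat -> nat -> R :=
  fun i j => partial_derive i j f x y.

Lemma is_derive_total_derivative (F : nat -> nat -> R -> R) (H : nat -> R -> R) (s : R) (k : nat) :
  (forall i j, is_derive (F i j) s (F (S i) j s + F i (S j) s * H 1%nat s)) ->
  (forall i, (i < 4)%nat -> is_derive (H i) s (H (S i) s)) -> (k < 4)%nat ->
  is_derive (fun x => total_derivative (fun i j => F i j x) (fun i => H i x) k) s
    (total_derivative (fun i j => F i j s) (fun i => H i s) (S k)).
Proof.
  intros HF HH Hk.
  assert (EF : forall i j, ex_derive (fun x => F i j x) s /\
    Derive (fun x => F i j x) s = F (S i) j s + F i (S j) s * H 1%nat s).
  { intros i j; split; [eexists; apply HF | apply is_derive_unique, HF]. }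
  assert (EH : forall i, (i < 4)%nat -> ex_derive (fun x => H i x) s /\
    Derive (fun x => H i x) s = H (S i) s).
  { intros i Hi; split; [eexists; apply HH, Hi | apply is_derive_unique, HH, Hi]. }
  assert (XF : forall i j, ex_derive (fun x => F i j x) s) by apply EF.
  destruct (EH 1%nat) as [G1 E1]; [lia|]; destruct (EH 2%nat) as [G2 E2]; [lia|].
  destruct (EH 3%nat) as [G3 E3]; [lia|].
  destruct k as [|[|[|[|k]]]]; [| | | | lia]; unfold total_derivative;
    [exact (HF 0%nat 0%nat) | | |];
    (auto_derive; [repeat split; auto |
      repeat match goal with |- context [Derive (fun x => F ?i ?j x) s] =>
        rewrite (proj2 (EF i j)) end; rewrite ?E1, ?E2, ?E3; ring]).
Qed.

Lemma tower_total_derivative (U : R * R -> Prop) (f : R -> R -> R) (c d : R)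
    (H : nat -> R -> R) :
  open U -> smooth_on U f -> tower c d 4 H ->
  (forall s, c < s < d -> U (s, H 0%nat s)) ->
  tower c d 4 (fun k s => total_derivative (partials f s (H 0%nat s)) (fun i => H i s) k).
Proof.
  intros HU Hf HT HG k Hk s Hs.
  apply (is_derive_total_derivative (fun i j x => partials f x (H 0%nat x) i j) H s k); auto.
  intros i j; apply (is_derive_partial_along U f i j (H 0%nat)); auto.
  apply HT; [lia | exact Hs].
Qed.

(** * From curves to arbitrary 4-jets *)

Definition taylor_curve (z : R) (h : nat -> R) (k : nat) (s : R) : R :=
  match k with
  | 0%nat => h 0%nat + h 1%nat * (s - z) + h 2%nat * (s - z) ^ 2 / 2 + h 3%nat * (s - z) ^ 3 / 6
         + h 4%nat * (s - z) ^ 4 / 24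
  | 1%nat => h 1%nat + h 2%nat * (s - z) + h 3%nat * (s - z) ^ 2 / 2 + h 4%nat * (s - z) ^ 3 / 6
  | 2%nat => h 2%nat + h 3%nat * (s - z) + h 4%nat * (s - z) ^ 2 / 2
  | 3%nat => h 3%nat + h 4%nat * (s - z)
  | _ => h 4%nat
  end.

Lemma tower_taylor_curve (c d z : R) (h : nat -> R) : tower c d 4 (taylor_curve z h).
Proof.
  intros k Hk s _.
  destruct k as [|[|[|[|k]]]]; [| | | | lia]; unfold taylor_curve;
    (auto_derive; [exact I | field]).
Qed.

Lemma taylor_curve_at (z : R) (h : nat -> R) (k : nat) :
  (k <= 4)%nat -> taylor_curve z h k z = h k.
Proof.
  intros Hk; destruct k as [|[|[|[|[|k]]]]]; [| | | | | lia]; unfold taylor_curve; field.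
Qed.

Lemma injective_of_Derive_neq_0 (Phi Phi' : R -> R) (c d : R) :
  (forall s, c < s < d -> is_derive Phi s (Phi' s)) ->
  (forall s, c < s < d -> Phi' s <> 0) ->
  forall x y, c < x < d -> c < y < d -> Phi x = Phi y -> x = y.
Proof.
  intros HD Hne x y Hx Hy E.
  assert (Hin : forall t, Rmin x y <= t <= Rmax x y -> c < t < d).
  { intros t; unfold Rmin, Rmax; destruct Rle_dec; lra. }
  destruct (MVT_gen Phi x y Phi') as (t & Ht & Et).
  - intros t Ht; apply HD, Hin; lra.
  - intros t Ht; apply continuity_pt_filterlim, (ex_derive_continuous Phi).
    exists (Phi' t); apply HD, Hin, Ht.
  - rewrite E in Et.
    assert (Hp : Phi' t * (y - x) = 0) by lra.
    apply Rmult_integral in Hp; destruct Hp as [Hp|Hp]; [|lra].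
    destruct (Hne t (Hin t Ht) Hp).
Qed.

Lemma exists_image_function (Phi Psi : R -> R) (c d : R) :
  (forall x y, c < x < d -> c < y < d -> Phi x = Phi y -> x = y) ->
  exists u : R -> R, forall s, c < s < d -> u (Phi s) = Psi s.
Proof.
  intros Hinj.
  (* Injectivity makes the value unique on the image of the interval; elsewhere it is an arbitrary
     choice. *)
  exists (fun t => epsilon (inhabits 0) (fun v => exists s, c < s < d /\ Phi s = t /\ v = Psi s)).
  intros s Hs.
  destruct (epsilon_spec (inhabits 0)
    (fun v => exists s', c < s' < d /\ Phi s' = Phi s /\ v = Psi s')) as (s' & Hs' & E & ->).
  - now exists (Psi s), s.
  - now rewrite (Hinj s' s Hs' Hs E).
Qed.

(** The jet [h] is realized by its Taylor polynomial at [z]. On a small interval the graph stays in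
    [U] and the derivative of [phi] along it does not vanish, so the image is the graph of some [u].
    The equivalence between equations thereby becomes pointwise, with free jet coordinates. *)
Lemma jet_equivalence (U : R * R -> Prop) (phi psi : R -> R -> R) (E : ode4)
    (a b : R -> R) (z : R) (h : nat -> R) :
  open U -> smooth_on U phi -> smooth_on U psi ->
  maps_equation U phi psi E (linear4 a b) -> U (z, h 0%nat) ->
  let f := total_derivative (partials phi z (h 0%nat)) h in
  let g := total_derivative (partials psi z (h 0%nat)) h in
  f 1%nat <> 0 ->
  (E z (h 0%nat) (h 1%nat) (h 2%nat) (h 3%nat) (h 4%nat) <->
   u4 f g + a (f 0%nat) * u1 f g + b (f 0%nat) * g 0%nat = 0).
Proof.
  intros HU Hphi Hpsi Hmap Hz f g Hf1.
  pose (H := taylor_curve z h).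
  assert (Hz0 : forall k, (k <= 4)%nat -> H k z = h k) by (intros; now apply taylor_curve_at).
  assert (HcH : forall s, continuous (H 0%nat) s).
  { intros s; apply (ex_derive_continuous (H 0%nat)); exists (H 1%nat s).
    apply (tower_taylor_curve (s - 1) (s + 1)); [lia | lra]. }
  assert (L1 : locally z (fun s => U (s, H 0%nat s))).
  { destruct (open_locally_2d U z (h 0%nat) HU Hz) as [e He].
    assert (L : locally z (fun s => Rabs (H 0%nat s - h 0%nat) < e)).
    { rewrite <- (Hz0 0%nat) by lia.
      apply (HcH z (fun y => Rabs (y - H 0%nat z) < e)).
      exists e; intros y Hy; exact Hy. }
    apply filter_and with (2 := L) in L; apply (filter_imp (fun s => Rabs (s - z) < e /\
      Rabs (H 0%nat s - h 0%nat) < e)).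
    - intros s [A B]; now apply He.
    - apply filter_and; [exists e; intros y Hy; exact Hy|].
      apply (filter_imp _ _ (fun s K => proj1 K) L). }
  destruct (interval_of_locally z _ L1) as (e1 & Hpos1 & HG1).
  pose (TP := fun (F : R -> R -> R) k s =>
    total_derivative (partials F s (H 0%nat s)) (fun i => H i s) k).
  assert (TPz : forall F k, TP F k z = total_derivative (partials F z (h 0%nat)) h k).
  { intros F k; unfold TP; rewrite (Hz0 0%nat) by lia.
    destruct k as [|[|[|[|k]]]]; unfold total_derivative; rewrite ?Hz0 by lia; reflexivity. }
  assert (L2 : locally z (fun s => TP phi 1%nat s <> 0)).
  { assert (C : continuous (TP phi 1%nat) z).
    { apply (ex_derive_continuous (TP phi 1%nat)); exists (TP phi 2%nat z).
      apply (tower_total_derivative U phi (z - e1) (z + e1) H); auto; try lia; try lra.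
      apply tower_taylor_curve. }
    apply (C (fun y => y <> 0)), open_neq; rewrite TPz; exact Hf1. }
  destruct (interval_of_locally z _ L2) as (e2 & Hpos2 & He2).
  set (e := Rmin e1 e2).
  assert (He : 0 < e /\ e <= e1 /\ e <= e2).
  { unfold e; repeat split; [apply Rmin_pos; lra | apply Rmin_l | apply Rmin_r]. }
  assert (HG : forall s, z - e < s < z + e -> U (s, H 0%nat s)).
  { intros s Hs; apply HG1; lra. }
  assert (Hne : forall s, z - e < s < z + e -> TP phi 1%nat s <> 0).
  { intros s Hs; apply He2; lra. }
  assert (TH : tower (z - e) (z + e) 4 H) by apply tower_taylor_curve.
  assert (T1 : tower (z - e) (z + e) 4 (TP phi)) by (apply (tower_total_derivative U); auto).
  assert (T2 : tower (z - e) (z + e) 4 (TP psi)) by (apply (tower_total_derivative U); auto).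
  assert (Hze : z - e < z < z + e) by lra.
  destruct (exists_image_function (TP phi 0%nat) (TP psi 0%nat) (z - e) (z + e)) as [u Hu].
  { apply (injective_of_Derive_neq_0 _ (TP phi 1%nat)); [|exact Hne].
    intros s Hs; apply T1; [lia | exact Hs]. }
  destruct (Derive_n_parametric (TP phi) (TP psi) u (z - e) (z + e) T1 T2 Hne Hu z Hze) as [D1 D4].
  assert (DH : forall k, (k <= 4)%nat -> Derive_n (H 0%nat) k z = h k).
  { intros k Hk; rewrite (tower_Derive_n (z - e) (z + e) 4 H); auto. }
  assert (M := Hmap (z - e) (z + e) (H 0%nat) u).
  specialize (M ltac:(intros s Hs k Hk; apply (tower_ex_derive_n (z - e) (z + e) 4 H); auto) HG).
  assert (M2 : forall s, z - e < s < z + e -> Derive (fun s => phi s (H 0%nat s)) s <> 0).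
  { intros s Hs; replace (Derive _ s) with (TP phi 1%nat s); [auto|].
    symmetry; apply is_derive_unique, (T1 0%nat); [lia | exact Hs]. }
  specialize (M M2 Hu z Hze); unfold holds_at, linear4 in M.
  rewrite !DH in M by lia.
  change (phi z (H 0%nat z)) with (TP phi 0%nat z) in M.
  rewrite D1, D4, Hu in M by exact Hze.
  rewrite (Hz0 0%nat) in M by lia.
  unfold u4, u3, u2, u1 in M |- *.
  rewrite !TPz in M.
  exact M.
Qed.

(** * The determining equations *)

Definition jet (h0 h1 h2 h3 h4 : R) (k : nat) : R :=
  match k with
  | 0%nat => h0 | 1%nat => h1 | 2%nat => h2 | 3%nat => h3 | _ => h4
  end.

(* The coefficient of [h2 h3] in [u4] is [-10 p01 J / f1^6], and it is isolated
   by a mixed second difference; [h1] is chosen so that [f1 = 1]. *)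
Lemma independent_variable_fiber_preserving (p q : nat -> nat -> R) (a b h0 c0 c1 c2 c3 : R) :
  p 0%nat 1%nat <> 0 ->
  (forall h2 h3,
     let h := jet h0 ((1 - p 1%nat 0%nat) / p 0%nat 1%nat) h2 h3
                (c3 * h3 + c2 * h2 ^ 2 + c1 * h2 + c0) in
     u4 (total_derivative p h) (total_derivative q h)
     + a * u1 (total_derivative p h) (total_derivative q h) + b * q 0%nat 0%nat = 0) ->
  p 1%nat 0%nat * q 0%nat 1%nat - p 0%nat 1%nat * q 1%nat 0%nat = 0.
Proof.
  intros Hp HS.
  assert (H11 := HS 1 1); assert (H10 := HS 1 0).
  assert (H01 := HS 0 1); assert (H00 := HS 0 0); clear HS.
  cbv zeta in *.
  unfold u4, u3, u2, u1, total_derivative, jet in *.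
  set (h1 := (1 - p 1%nat 0%nat) / p 0%nat 1%nat) in *.
  assert (E : p 1%nat 0%nat = 1 - p 0%nat 1%nat * h1) by (unfold h1; field; exact Hp).
  rewrite E in *; clearbody h1; clear E.
  (* All denominators become 1. The combination [H11 - H10 - H01 + H00] then leaves only [-10 * p01]
     times the Jacobian. *)
  replace (1 - p 0%nat 1%nat * h1 + p 0%nat 1%nat * h1) with 1 in * by ring.
  unfold Rdiv in *; rewrite !pow1, !Rinv_1 in *.
  apply Rmult_eq_reg_l with (p 0%nat 1%nat); [|exact Hp].
  lra.
Qed.

Lemma coefficient_comparison (p : nat -> nat -> R) (alpha beta gam m W A B C E h0 : R) :
  W <> 0 ->
  (forall h1 h2 h3,
     let h := jet h0 h1 h2 h3 (- (alpha * h1 * h3 + beta * h2 ^ 2 + m * h2 + 2 * gam * h1 ^ 2) / W) in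
     let g := total_derivative p h in
     g 4%nat + A * g 3%nat + B * g 2%nat + C * g 1%nat + E * g 0%nat = 0) ->
  4 * W * p 0%nat 2%nat = alpha * p 0%nat 1%nat /\
  3 * W * p 0%nat 2%nat = beta * p 0%nat 1%nat /\
  p 0%nat 3%nat = 0 /\
  4 * p 1%nat 1%nat + A * p 0%nat 1%nat = 0 /\
  W * (6 * p 2%nat 1%nat + 3 * A * p 1%nat 1%nat + B * p 0%nat 1%nat) = m * p 0%nat 1%nat /\
  W * (6 * p 2%nat 2%nat + 3 * A * p 1%nat 2%nat + B * p 0%nat 2%nat) = 2 * gam * p 0%nat 1%nat.
Proof.
  intros HW HN.
  (* [g 4] is affine in [h4] with slope [p01]. Multiplying by [W] moves the substituted [h4] to the
     right-hand side and leaves a polynomial identity in [h1], [h2], [h3]. *)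
  assert (HM : forall h1 h2 h3,
    let h := jet h0 h1 h2 h3 0 in let g := total_derivative p h in
    W * (g 4%nat + A * g 3%nat + B * g 2%nat + C * g 1%nat + E * g 0%nat) =
    p 0%nat 1%nat * (alpha * h1 * h3 + beta * h2 ^ 2 + m * h2 + 2 * gam * h1 ^ 2)).
  { intros h1 h2 h3; specialize (HN h1 h2 h3).
    set (S := alpha * h1 * h3 + beta * h2 ^ 2 + m * h2 + 2 * gam * h1 ^ 2) in *.
    assert (HS : p 0%nat 1%nat * (W * (- S / W)) = - (p 0%nat 1%nat * S)) by (field; exact HW).
    apply (f_equal (fun t => W * t)) in HN; unfold total_derivative, jet in *.
    clearbody S; cbv zeta in *; lra. }
  clear HN; unfold total_derivative, jet in HM; cbv zeta in HM.
  (* The coefficients are extracted by sampling. In [h1] alone the degree is four, hence the five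
     values -2, -1, 0, 1, 2; in the names, [m] stands for -1 and [n] for -2. *)
  pose proof (HM 0 0 0) as N000. pose proof (HM 0 0 1) as N001.
  pose proof (HM 1 0 0) as N100. pose proof (HM 1 0 1) as N101.
  pose proof (HM 0 1 0) as N010. pose proof (HM 0 (-1) 0) as N0m0.
  pose proof (HM 1 1 0) as N110. pose proof (HM 1 (-1) 0) as N1m0.
  pose proof (HM (-1) 1 0) as Nm10. pose proof (HM (-1) (-1) 0) as Nmm0.
  pose proof (HM (-1) 0 0) as Nm00. pose proof (HM 2 0 0) as N200.
  pose proof (HM (-2) 0 0) as Nn00. clear HM.
  assert (E3 : W * p 0%nat 3%nat = 0) by lra.
  assert (E4 : W * (4 * p 1%nat 1%nat + A * p 0%nat 1%nat) = 0) by lra.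
  repeat split; try lra.
  - destruct (Rmult_integral _ _ E3); [contradiction | assumption].
  - destruct (Rmult_integral _ _ E4); [contradiction | assumption].
Qed.

Lemma is_derive_locally_zero (f : R -> R) (x l : R) :
  locally x (fun y => f y = 0) -> is_derive f x l -> l = 0.
Proof.
  intros Hf Hl; rewrite <- (is_derive_unique f x l Hl).
  rewrite (Derive_ext_loc f (fun _ => 0)); [apply Derive_const | exact Hf].
Qed.

(** A function vanishing on an open set has vanishing derivatives there: first [j] is raised with
    [i = 0], then [i]. *)
Lemma partial_derive_zero (U : R * R -> Prop) (f : R -> R -> R) :
  open U -> smooth_on U f ->
  (forall x y, U (x, y) -> partial_derive 0 1 f x y = 0) ->
  forall i j x y, U (x, y) -> partial_derive i (S j) f x y = 0.
Proof.
  intros HU Hf H0 i j; induction i as [|i IHi].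
  - induction j as [|j IHj]; [exact H0|].
    intros x y Hxy.
    apply (is_derive_locally_zero (fun v => partial_derive 0 (S j) f x v) y).
    + apply (locally_2d_1d_const_x (fun u v => partial_derive 0 (S j) f u v = 0)).
      apply locally_2d_impl with (2 := open_locally_2d U x y HU Hxy).
      apply locally_2d_forall; intros u v; apply IHj.
    + apply (is_derive_snd_partial U); auto.
  - intros x y Hxy.
    apply (is_derive_locally_zero (fun v => partial_derive i (S j) f v y) x).
    + apply (locally_2d_1d_const_y (fun u v => partial_derive i (S j) f u v = 0)).
      apply locally_2d_impl with (2 := open_locally_2d U x y HU Hxy).
      apply locally_2d_forall; intros u v; apply IHi.
    + apply (is_derive_fst_partial U); auto.
Qed.

Lemma is_derive_wronskian (f f1 g g1 : R -> R) (x f2 g2 : R) :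
  is_derive f x (f1 x) -> is_derive f1 x f2 -> is_derive g x (g1 x) -> is_derive g1 x g2 ->
  is_derive (fun s => f1 s * g s - f s * g1 s) x (f2 * g x - f x * g2).
Proof.
  intros Hf Hf1 Hg Hg1.
  replace (f2 * g x - f x * g2) with
    (minus (plus (mult f2 (g x)) (mult (f1 x) (g1 x))) (plus (mult (f1 x) (g1 x)) (mult (f x) g2)))
    by (unfold minus, plus, opp, mult; simpl; ring).
  apply (is_derive_minus (fun s => f1 s * g s) (fun s => f s * g1 s)).
  - apply (is_derive_mult f1 g); [exact Hf1 | exact Hg | exact Rmult_comm].
  - apply (is_derive_mult f g1); [exact Hf | exact Hg1 | exact Rmult_comm].
Qed.

Definition profile_solve (alpha beta gamma mu nu kappa D h0 h1 h2 h3 : R) : R :=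
  - (alpha * h1 * h3 + beta * h2 ^ 2 + (2 * gamma * h0 + kappa - D ^ 2) * h2
     + 2 * gamma * h1 ^ 2) / (nu * h0 + mu * D ^ 2).

Lemma profile_solve_spec (alpha beta gamma mu nu kappa D z h0 h1 h2 h3 : R) :
  nu * h0 + mu * D ^ 2 <> 0 ->
  profile_equation alpha beta gamma mu nu kappa D z h0 h1 h2 h3
    (profile_solve alpha beta gamma mu nu kappa D h0 h1 h2 h3).
Proof. intros HW; unfold profile_equation, profile_solve; field; exact HW. Qed.

(** * Constraints on the constants imposed by a linearization *)

Section Necessity.

Variables alpha beta gamma mu nu kappa D : R.
Variables (U : R * R -> Prop) (phi psi : R -> R -> R) (a b : R -> R).
Hypothesis HU : open U.
Hypothesis HUR : forall q, U q -> profile_region mu nu D q.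
Hypothesis Hpt : point_transformation U phi psi.
Hypothesis Hmap : maps_equation U phi psi
  (profile_equation alpha beta gamma mu nu kappa D) (linear4 a b).

Let Hphi : smooth_on U phi := proj1 Hpt.
Let Hpsi : smooth_on U psi := proj1 (proj2 Hpt).

Lemma jacobian_partials (z h : R) : U (z, h) ->
  partials phi z h 1%nat 0%nat * partials psi z h 0%nat 1%nat
  - partials phi z h 0%nat 1%nat * partials psi z h 1%nat 0%nat <> 0.
Proof. exact (proj2 (proj2 Hpt) z h). Qed.

Lemma partial_snd_zero (z h : R) : U (z, h) -> partial_derive 0 1 phi z h = 0.
Proof.
  intros Hz; destruct (Req_dec (partial_derive 0 1 phi z h) 0) as [|Hne]; [assumption|].
  exfalso; apply (jacobian_partials z h Hz).
  pose proof (HUR _ Hz) as HW; unfold profile_region in HW; simpl snd in HW.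
  set (W := nu * h + mu * D ^ 2) in HW.
  set (h1 := (1 - partials phi z h 1%nat 0%nat) / partials phi z h 0%nat 1%nat).
  (* The four constants are the coefficients of 1, [h2], [h2 ^ 2] and [h3] in the value of [h4]
     solved from the profile equation. *)
  apply (independent_variable_fiber_preserving _ _ (a (phi z h)) (b (phi z h)) h
    (- (2 * gamma * h1 ^ 2) / W) (- (2 * gamma * h + kappa - D ^ 2) / W) (- beta / W)
    (- (alpha * h1) / W)); [exact Hne|].
  intros h2 h3; cbv zeta; fold h1.
  set (h4 := _ + _ + _ + _).
  apply (jet_equivalence U phi psi _ a b z (jet h h1 h2 h3 h4) HU Hphi Hpsi Hmap Hz).
  - unfold total_derivative, jet, h1; replace (_ + _) with 1; [lra|].
    field; exact Hne.
  - unfold jet; replace h4 with (profile_solve alpha beta gamma mu nu kappa D h h1 h2 h3).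
    + apply profile_solve_spec, HW.
    + unfold profile_solve, h4; fold W; field; exact HW.
Qed.

Let fz (k : nat) (z h : R) : R := partial_derive k 0 phi z h.
(** Once [phi_H = 0], multiplying [u'''' + a u' + b u] by [phi_z ^ 4] gives a linear operator in
    [G = psi(z, H(z))] with leading coefficient 1; [coefA] and [coefB] are its coefficients of
    [G'''] and [G'']. *)
Let coefA (z h : R) : R := - 6 * fz 2 z h / fz 1 z h.
Let coefB (z h : R) : R := (15 * fz 2 z h ^ 2 - 4 * fz 1 z h * fz 3 z h) / fz 1 z h ^ 2.

Lemma fst_snd_partials_neq_0 (z h : R) : U (z, h) ->
  fz 1 z h <> 0 /\ partials psi z h 0%nat 1%nat <> 0.
Proof.
  intros Hz; pose proof (jacobian_partials z h Hz) as HJ.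
  replace (partials phi z h 0%nat 1%nat) with 0 in HJ
    by (symmetry; exact (partial_snd_zero z h Hz)).
  split; intros E; apply HJ; [unfold fz in E; unfold partials at 1|]; rewrite E; ring.
Qed.

Lemma determining_equations (z h : R) : U (z, h) ->
  let p := partials psi z h in let A := coefA z h in let B := coefB z h in
  let W := nu * h + mu * D ^ 2 in let m := 2 * gamma * h + kappa - D ^ 2 in
  4 * W * p 0%nat 2%nat = alpha * p 0%nat 1%nat /\
  3 * W * p 0%nat 2%nat = beta * p 0%nat 1%nat /\
  p 0%nat 3%nat = 0 /\
  4 * p 1%nat 1%nat + A * p 0%nat 1%nat = 0 /\
  W * (6 * p 2%nat 1%nat + 3 * A * p 1%nat 1%nat + B * p 0%nat 1%nat) = m * p 0%nat 1%nat /\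
  W * (6 * p 2%nat 2%nat + 3 * A * p 1%nat 2%nat + B * p 0%nat 2%nat) = 2 * gamma * p 0%nat 1%nat.
Proof.
  intros Hz p A B W m.
  destruct (fst_snd_partials_neq_0 z h Hz) as [Hf1 _].
  set (f1 := fz 1 z h) in *; set (f2 := fz 2 z h) in *; set (f3 := fz 3 z h) in *.
  set (f4 := fz 4 z h).
  (* The two long arguments are the coefficients of [G'] and [G] in the same operator; the functions
     [a] and [b] enter only through them. *)
  apply (coefficient_comparison p alpha beta gamma m W A B
    ((10 * f1 * f2 * f3 - 15 * f2 ^ 3 - f1 ^ 2 * f4) / f1 ^ 3 + a (phi z h) * f1 ^ 3)
    (b (phi z h) * f1 ^ 4) h (HUR _ Hz)).
  intros h1 h2 h3; cbv zeta.
  change (- _ / W) with (profile_solve alpha beta gamma mu nu kappa D h h1 h2 h3).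
  set (h4 := profile_solve _ _ _ _ _ _ _ _ _ _ _).
  pose (f := total_derivative (partials phi z h) (jet h h1 h2 h3 h4)).
  (* Since [phi_H = 0] on [U], total derivatives of [phi] are pure [z]-derivatives. *)
  assert (Hf : f 1%nat = f1 /\ f 2%nat = f2 /\ f 3%nat = f3 /\ f 4%nat = f4).
  { unfold f, total_derivative, partials; fold f1 f2 f3 f4.
    rewrite !(partial_derive_zero U phi HU Hphi partial_snd_zero) by exact Hz.
    unfold f1, f2, f3, f4, fz; repeat split; ring. }
  destruct Hf as (F1 & F2 & F3 & F4).
  assert (J := proj1 (jet_equivalence U phi psi _ a b z (jet h h1 h2 h3 h4) HU Hphi Hpsi Hmap Hz
    ltac:(change (f 1%nat <> 0); rewrite F1; exact Hf1))
    (profile_solve_spec _ _ _ _ _ _ _ _ _ _ _ _ (HUR _ Hz))).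
  change (total_derivative (partials phi z (jet h h1 h2 h3 h4 0%nat)) (jet h h1 h2 h3 h4)) with f in J.
  change (total_derivative (partials psi z (jet h h1 h2 h3 h4 0%nat)) (jet h h1 h2 h3 h4))
    with (total_derivative p (jet h h1 h2 h3 h4)) in J.
  change (f 0%nat) with (phi z h) in J.
  set (g := total_derivative p (jet h h1 h2 h3 h4)) in *.
  unfold u4, u3, u2, u1 in J; rewrite F1, F2, F3, F4 in J.
  apply Rmult_eq_reg_l with (/ f1 ^ 4); [|now apply Rinv_neq_0_compat, pow_nonzero].
  rewrite Rmult_0_r, <- J; unfold A, B, coefA, coefB; fold f1 f2 f3.
  clearbody f1 f2 f3 f4 g; field; exact Hf1.
Qed.

(** A vertical section of [U] may be disconnected, so the mean value theorem is applied on a segment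
    assumed to lie in [U]. *)
Lemma fz_constant_in_snd (k : nat) (z h h' : R) :
  (forall v, Rmin h h' <= v <= Rmax h h' -> U (z, v)) -> fz k z h = fz k z h'.
Proof.
  intros Hseg.
  destruct (MVT_gen (fun v => fz k z v) h h' (fun v => partial_derive k 1 phi z v)) as (t & Ht & E).
  - intros v Hv; apply (is_derive_snd_partial U); auto; apply Hseg; lra.
  - intros v Hv; apply continuity_pt_filterlim, (ex_derive_continuous (fun v => fz k z v)).
    eexists; apply (is_derive_snd_partial U); auto.
  - rewrite (partial_derive_zero U phi HU Hphi partial_snd_zero) in E by auto; lra.
Qed.

Lemma fst_derivative_of_zero (F : R -> R -> R) (z h l : R) :
  (forall x y, U (x, y) -> F x y = 0) -> U (z, h) ->
  is_derive (fun x => F x h) z l -> l = 0.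
Proof.
  intros HF Hz; apply is_derive_locally_zero.
  apply (locally_2d_1d_const_y (fun u v => F u v = 0)).
  apply locally_2d_impl with (2 := open_locally_2d U z h HU Hz).
  apply locally_2d_forall; intros u v; apply HF.
Qed.

Lemma snd_derivative_of_zero (F : R -> R -> R) (z h l : R) :
  (forall x y, U (x, y) -> F x y = 0) -> U (z, h) ->
  is_derive (fun y => F z y) h l -> l = 0.
Proof.
  intros HF Hz; apply is_derive_locally_zero.
  apply (locally_2d_1d_const_x (fun u v => F u v = 0)).
  apply locally_2d_impl with (2 := open_locally_2d U z h HU Hz).
  apply locally_2d_forall; intros u v; apply HF.
Qed.

Lemma is_derive_lincomb (f g : R -> R) (c d x f' g' : R) :
  is_derive f x f' -> is_derive g x g' ->
  is_derive (fun t => c * f t - d * g t) x (c * f' - d * g').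
Proof.
  intros Hf Hg; apply (is_derive_minus (fun t => c * f t) (fun t => d * g t));
    apply (is_derive_scal _ x _ _); assumption.
Qed.

(** The factor [W] does not involve [z], so [4 W psi_HH = alpha psi_H] survives any number of
    [z]-differentiations. *)
Lemma psi_snd_relation (i : nat) (z h : R) : U (z, h) ->
  4 * (nu * h + mu * D ^ 2) * partial_derive i 2 psi z h - alpha * partial_derive i 1 psi z h = 0.
Proof.
  revert z h; induction i as [|i IH]; intros z h Hz.
  - destruct (determining_equations z h Hz) as [E _]; unfold partials in E; lra.
  - apply (fst_derivative_of_zero (fun z h => 4 * (nu * h + mu * D ^ 2) * partial_derive i 2 psi z h
      - alpha * partial_derive i 1 psi z h) z h); [exact IH | exact Hz |].
    apply is_derive_lincomb; apply (is_derive_fst_partial U); auto.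
Qed.

Lemma necessary_conditions (z h : R) : U (z, h) ->
  alpha * (alpha - 4 * nu) = 0 /\ 3 * alpha = 4 * beta /\
  2 * gamma * (mu * D ^ 2) = nu * (kappa - D ^ 2) /\ gamma * (alpha - 4 * nu) = 0.
Proof.
  intros Hz.
  destruct (determining_equations z h Hz) as (E1 & E2 & E3 & E4 & E5 & E6).
  destruct (fst_snd_partials_neq_0 z h Hz) as [_ HX].
  pose proof (HUR _ Hz) as HW; unfold profile_region in HW; simpl snd in HW.
  pose proof (psi_snd_relation 1 z h Hz) as R1; pose proof (psi_snd_relation 2 z h Hz) as R2.
  change (partial_derive 1 2 psi z h) with (partials psi z h 1%nat 2%nat) in R1.
  change (partial_derive 1 1 psi z h) with (partials psi z h 1%nat 1%nat) in R1.
  change (partial_derive 2 2 psi z h) with (partials psi z h 2%nat 2%nat) in R2.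
  change (partial_derive 2 1 psi z h) with (partials psi z h 2%nat 1%nat) in R2.
  (* This is the [H]-derivative of the same relation; with [psi_HHH = 0] it reads
     [(4 nu - alpha) psi_HH = 0]. *)
  assert (R3 : 4 * nu * partials psi z h 0%nat 2%nat
    + 4 * (nu * h + mu * D ^ 2) * partials psi z h 0%nat 3%nat
    - alpha * partials psi z h 0%nat 2%nat = 0).
  { apply (snd_derivative_of_zero (fun z h => 4 * (nu * h + mu * D ^ 2) * partial_derive 0 2 psi z h
      - alpha * partial_derive 0 1 psi z h) z h); [exact (psi_snd_relation 0) | exact Hz |].
    pose proof (is_derive_snd_partial U psi 0 2 z h HU Hpsi Hz) as P2.
    pose proof (is_derive_snd_partial U psi 0 1 z h HU Hpsi Hz) as P1.
    replace (4 * nu * _ + _ - _) with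
      (plus (4 * (plus (nu * 1) 0) * partial_derive 0 2 psi z h
        + 4 * (nu * h + mu * D ^ 2) * partial_derive 0 3 psi z h)
       (- (alpha * partial_derive 0 2 psi z h))) by (unfold plus, partials; simpl; ring).
    apply (is_derive_plus (fun v => 4 * (nu * v + mu * D ^ 2) * partial_derive 0 2 psi z v)).
    - apply (is_derive_mult (fun v => 4 * (nu * v + mu * D ^ 2))); [|exact P2|exact Rmult_comm].
      auto_derive; [exact I | unfold plus; simpl; ring].
    - apply (is_derive_opp (fun v => alpha * partial_derive 0 1 psi z v)), (is_derive_scal _ h alpha _), P1. }
  assert (H3 : 2 * gamma * (mu * D ^ 2) = nu * (kappa - D ^ 2)).
  (* The equations are compared at two heights [h] and [k] inside a box contained in [U], where [A]
     and [B] take the same values at both heights. *)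
  { destruct (open_locally_2d U z h HU Hz) as [e He]; pose proof (cond_pos e) as Hpos.
    set (k := h + e / 2).
    assert (Hbox : forall s v, z - e < s < z + e -> h <= v <= k -> U (s, v)).
    { intros s v Hs Hv; apply He; apply Rabs_def1; unfold k in Hv; lra. }
    assert (Hzk : U (z, k)) by (apply Hbox; unfold k; lra).
    assert (HW' := HUR _ Hzk); unfold profile_region in HW'; simpl snd in HW'.
    assert (Hfz : forall i s, z - e < s < z + e -> fz i s h = fz i s k).
    { intros i s Hs; apply fz_constant_in_snd; intros v Hv; apply Hbox; [exact Hs|].
      unfold k in *; rewrite Rmin_left, Rmax_right in Hv by lra; exact Hv. }
    destruct (determining_equations z k Hzk) as (_ & _ & _ & F4 & F5 & _).
    destruct (fst_snd_partials_neq_0 z k Hzk) as [_ HY].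
    assert (HA : forall s, z - e < s < z + e -> coefA s h = coefA s k).
    { intros s Hs; unfold coefA; now rewrite !Hfz. }
    assert (HB : coefB z h = coefB z k) by (unfold coefB; rewrite !Hfz; lra).
    (* [4 psi_zH + A psi_H = 0] with the same [A] on both slices: [psi_H(., h)] and [psi_H(., k)]
       are proportional, so their Wronskian vanishes identically. *)
    assert (Q : partials psi z h 2%nat 1%nat * partials psi z k 0%nat 1%nat
      - partials psi z h 0%nat 1%nat * partials psi z k 2%nat 1%nat = 0).
    { apply (is_derive_locally_zero (fun s => partial_derive 1 1 psi s h * partial_derive 0 1 psi s k
        - partial_derive 0 1 psi s h * partial_derive 1 1 psi s k) z).
      - apply (locally_of_interval (z - e) (z + e)); [lra|].
        intros s Hs.
        assert (Us : U (s, h)) by (apply Hbox; unfold k; lra).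
        assert (Vs : U (s, k)) by (apply Hbox; unfold k; lra).
        destruct (determining_equations s h Us) as (_ & _ & _ & S4 & _).
        destruct (determining_equations s k Vs) as (_ & _ & _ & T4 & _).
        rewrite HA in S4 by exact Hs; unfold partials in S4, T4.
        set (X := partial_derive 0 1 psi s h) in *; set (Y := partial_derive 0 1 psi s k) in *.
        replace (partial_derive 1 1 psi s h) with (- coefA s k * X / 4) by lra.
        replace (partial_derive 1 1 psi s k) with (- coefA s k * Y / 4) by lra.
        field.
      - pose proof (is_derive_fst_partial U psi 1 1 z h Hpsi Hz) as P1.
        pose proof (is_derive_fst_partial U psi 0 1 z h Hpsi Hz) as P2.
        pose proof (is_derive_fst_partial U psi 1 1 z k Hpsi Hzk) as P3.
        pose proof (is_derive_fst_partial U psi 0 1 z k Hpsi Hzk) as P4.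
        exact (is_derive_wronskian (fun s => partial_derive 0 1 psi s h) (fun s => partial_derive 1 1 psi s h)
          (fun s => partial_derive 0 1 psi s k) (fun s => partial_derive 1 1 psi s k) z _ _ P2 P1 P4 P3). }
    rewrite <- HB, <- (HA z) in F5 by lra; rewrite <- (HA z) in F4 by lra.
    set (A := coefA z h) in *; set (B := coefB z h) in *.
    set (X := partials psi z h 0%nat 1%nat) in *; set (Y := partials psi z k 0%nat 1%nat) in *.
    set (X1 := partials psi z h 1%nat 1%nat) in *; set (Y1 := partials psi z k 1%nat 1%nat) in *.
    set (X2 := partials psi z h 2%nat 1%nat) in *; set (Y2 := partials psi z k 2%nat 1%nat) in *.
    (* Eliminating [X1] and [Y1] and cross-multiplying [E5] and [F5], the terms in [A] and [B]
       cancel, and [Q] removes the rest: [m / W] agrees at [h] and [k]. The difference of the cross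
       products is the factor [(k - h) * (...)] shown here. *)
    assert (K : X * Y * (k - h) * (2 * gamma * (mu * D ^ 2) - nu * (kappa - D ^ 2)) = 0).
    { set (V := nu * h + mu * D ^ 2) in *; set (V' := nu * k + mu * D ^ 2) in *.
      replace X1 with (- A * X / 4) in * by lra. replace Y1 with (- A * Y / 4) in * by lra.
      transitivity ((2 * gamma * k + kappa - D ^ 2) * Y * (V * X)
        - (2 * gamma * h + kappa - D ^ 2) * X * (V' * Y)); [unfold V, V'; ring|].
      rewrite <- E5, <- F5.
      transitivity (- 6 * V * V' * (X2 * Y - X * Y2)); [field | rewrite Q; ring]. }
    assert (Hk : k - h <> 0) by (unfold k; lra).
    apply Rmult_integral in K; destruct K as [K|K]; [|lra].
    exfalso; revert K; repeat (apply Rmult_integral_contrapositive; split); assumption. }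
  clear E4.
  set (X := partials psi z h 0%nat 1%nat) in *; set (X02 := partials psi z h 0%nat 2%nat) in *.
  repeat split.
  - rewrite E3 in R3.
    assert (K : X * (alpha * (alpha - 4 * nu)) = 0).
    { transitivity ((alpha - 4 * nu) * (alpha * X)); [ring|].
      rewrite <- E1; transitivity (- (4 * (nu * h + mu * D ^ 2)) * (4 * nu * X02 - alpha * X02));
        [ring | replace (4 * nu * X02 - alpha * X02) with 0 by lra; ring]. }
    destruct (Rmult_integral _ _ K); [contradiction | assumption].
  - apply Rmult_eq_reg_r with X; [lra | exact HX].
  - exact H3.
  - set (V := nu * h + mu * D ^ 2) in *.
    (* By [R2], [R1] and [E1], the bracket of [E6] times [4 V] equals [alpha] times the bracket of
       [E5]. *)
    assert (K : alpha * (2 * gamma * h + kappa - D ^ 2) = 8 * gamma * V).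
    { apply Rmult_eq_reg_r with X; [|exact HX].
      transitivity (alpha * ((2 * gamma * h + kappa - D ^ 2) * X)); [ring|].
      rewrite <- E5; transitivity (4 * V * (2 * gamma * X)); [|ring].
      rewrite <- E6.
      apply Rminus_diag_uniq.
      transitivity (- V * (6 * (4 * V * partials psi z h 2%nat 2%nat - alpha * partials psi z h 2%nat 1%nat)
        + 3 * coefA z h * (4 * V * partials psi z h 1%nat 2%nat - alpha * partials psi z h 1%nat 1%nat)
        + coefB z h * (4 * V * X02 - alpha * X))); [ring|].
      rewrite R1, R2, E1; ring. }
    (* By [H3], [nu * m = 2 * gamma * V]; multiplying [K] by [nu] turns its left side into
       [2 * alpha * gamma * V]. *)
    apply Rmult_eq_reg_r with (2 * V); [|lra].
    transitivity (alpha * (2 * gamma * V) - nu * (8 * gamma * V)); [ring|].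
    rewrite <- K; replace (2 * gamma * V) with (nu * (2 * gamma * h + kappa - D ^ 2)) by (unfold V; lra).
    ring.
Qed.

End Necessity.

(** * Reduction of [G'''' + 10 q G'' = 0] to Laguerre-Forsyth form *)

(** Each derivative is only asserted to exist on the interval, so closure under sums, products and
    inverses follows by induction without formulas for higher derivatives. *)
Fixpoint derivable_upto (c d : R) (n : nat) (f : R -> R) : Prop :=
  match n with
  | 0%nat => True
  | S n => exists f', (forall x, c < x < d -> is_derive f x (f' x)) /\ derivable_upto c d n f'
  end.

Lemma derivable_upto_tower (c d : R) (n : nat) (f : R -> R) :
  derivable_upto c d n f -> exists T, T 0%nat = f /\ tower c d n T.
Proof.
  revert f; induction n as [|n IH]; intros f Hf.
  - exists (fun _ => f); split; [reflexivity | intros k Hk; lia].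
  - destruct Hf as (f' & Hd & Hf'); destruct (IH f' Hf') as (T & HT0 & HT).
    exists (fun k => match k with 0%nat => f | S k => T k end); split; [reflexivity|].
    intros [|k] Hk s Hs; [rewrite HT0; auto | apply HT; [lia | exact Hs]].
Qed.

Lemma derivable_upto_ex_derive_n (c d : R) (f : R -> R) :
  (forall n, derivable_upto c d n f) -> forall n x, c < x < d -> ex_derive_n f n x.
Proof.
  intros Hf n x Hx; destruct (derivable_upto_tower c d n f (Hf n)) as (T & HT0 & HT).
  apply (tower_ex_derive_n c d n T); auto; now rewrite HT0.
Qed.

Lemma derivable_upto_pred (c d : R) (n : nat) (f : R -> R) :
  derivable_upto c d (S n) f -> derivable_upto c d n f.
Proof.
  revert f; induction n as [|n IH]; intros f Hf; [exact I|].
  destruct Hf as (f' & Hd & Hf'); exists f'; split; [exact Hd | apply IH, Hf'].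
Qed.

Lemma derivable_upto_const (c d k : R) (n : nat) : derivable_upto c d n (fun _ => k).
Proof.
  revert k; induction n as [|n IH]; intros k; [exact I|].
  exists (fun _ => 0); split; [intros x _; apply (is_derive_const k) | apply IH].
Qed.

Lemma derivable_upto_id (c d : R) (n : nat) : derivable_upto c d n (fun x => x).
Proof.
  destruct n as [|n]; [exact I|].
  exists (fun _ => 1); split; [intros x _; apply (is_derive_id x) | apply derivable_upto_const].
Qed.

Lemma derivable_upto_plus (c d : R) (n : nat) (f g : R -> R) :
  derivable_upto c d n f -> derivable_upto c d n g -> derivable_upto c d n (fun x => f x + g x).
Proof.
  revert f g; induction n as [|n IH]; intros f g Hf Hg; [exact I|].
  destruct Hf as (f' & Hfd & Hf'); destruct Hg as (g' & Hgd & Hg').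
  exists (fun x => f' x + g' x); split; [|auto].
  intros x Hx; apply (is_derive_plus f g); auto.
Qed.

Lemma derivable_upto_mult (c d : R) (n : nat) (f g : R -> R) :
  derivable_upto c d n f -> derivable_upto c d n g -> derivable_upto c d n (fun x => f x * g x).
Proof.
  revert f g; induction n as [|n IH]; intros f g Hf Hg; [exact I|].
  assert (Hf0 := derivable_upto_pred _ _ _ _ Hf); assert (Hg0 := derivable_upto_pred _ _ _ _ Hg).
  destruct Hf as (f' & Hfd & Hf'); destruct Hg as (g' & Hgd & Hg').
  exists (fun x => f' x * g x + f x * g' x); split; [|apply derivable_upto_plus; auto].
  intros x Hx; apply (is_derive_mult f g); [auto | auto | exact Rmult_comm].
Qed.

Lemma derivable_upto_inv (c d : R) (n : nat) (f : R -> R) :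
  (forall x, c < x < d -> f x <> 0) ->
  derivable_upto c d n f -> derivable_upto c d n (fun x => / f x).
Proof.
  intros Hne; induction n as [|n IH]; intros Hf; [exact I|].
  assert (Hi := IH (derivable_upto_pred _ _ _ _ Hf)).
  destruct Hf as (f' & Hfd & Hf').
  exists (fun x => -1 * (f' x * (/ f x * / f x))); split.
  - intros x Hx; replace (_ * _) with (- f' x / f x ^ 2) by (field; auto).
    apply is_derive_inv; auto.
  - apply derivable_upto_mult; [apply derivable_upto_const|].
    apply derivable_upto_mult; [exact Hf'|]; apply derivable_upto_mult; exact Hi.
Qed.

Lemma derivable_upto_exp (c d w : R) (n : nat) : derivable_upto c d n (fun x => exp (w * x)).
Proof.
  induction n as [|n IH]; [exact I|].
  exists (fun x => w * exp (w * x)); split.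
  - intros x _; auto_derive; [exact I | ring].
  - apply derivable_upto_mult; [apply derivable_upto_const | exact IH].
Qed.

Lemma derivable_upto_sin_cos (c d w z : R) (n : nat) :
  derivable_upto c d n (fun x => sin (w * (x - z))) /\
  derivable_upto c d n (fun x => cos (w * (x - z))).
Proof.
  induction n as [|n [IHs IHc]]; [split; exact I|]; split.
  - exists (fun x => w * cos (w * (x - z))); split.
    + intros x _; auto_derive; [exact I | unfold Rminus; ring].
    + apply derivable_upto_mult; [apply derivable_upto_const | exact IHc].
  - exists (fun x => - w * sin (w * (x - z))); split.
    + intros x _; auto_derive; [exact I | unfold Rminus; ring].
    + apply derivable_upto_mult; [apply derivable_upto_const | exact IHs].
Qed.

Lemma ex_derive_n_Derive (f : R -> R) (x : R) :
  (forall n, ex_derive_n f n x) -> forall n, ex_derive_n (Derive f) n x.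
Proof.
  intros Hf [|n]; [exact I|].
  apply (ex_derive_ext (Derive_n f (S n))); [|exact (Hf (S (S n)))].
  intros t; symmetry; rewrite <- Nat.add_1_r; exact (Derive_n_comp f n 1 t).
Qed.

(** Both partial derivatives of [f u * g v] are again products of this shape, so the induction
    closes. The scalar rules for [Derive] hold without differentiability, which makes the equalities
    of functions global. *)
Lemma ex_diff_n_tensor (f g : R -> R) (x y : R) (n : nat) :
  (forall k, ex_derive_n f k x) -> (forall k, ex_derive_n g k y) ->
  ex_diff_n (fun u v => f u * g v) n x y.
Proof.
  revert f g; induction n as [|n IH]; intros f g Hf Hg.
  all: assert (Hc : continuity_2d_pt (fun u v => f u * g v) x y) by
    (apply (continuity_2d_pt_mult (fun u _ => f u) (fun _ v => g v));
     [ apply (continuity_1d_2d_pt_comp f (fun u _ => u)); [|apply continuity_2d_pt_id1]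
     | apply (continuity_1d_2d_pt_comp g (fun _ v => v)); [|apply continuity_2d_pt_id2] ];
     apply continuity_pt_filterlim; [apply (ex_derive_continuous f x), (Hf 1%nat)
       | apply (ex_derive_continuous g y), (Hg 1%nat)]).
  - split; [exact Hc | exact I].
  - split; [exact Hc|]; repeat split.
    + apply (ex_derive_scal_l f x (g y)), (Hf 1%nat).
    + apply (ex_derive_scal g (f x) y), (Hg 1%nat).
    + replace (fun u v => Derive (fun z => f z * g v) u) with (fun u v => Derive f u * g v).
      * apply IH; [now apply ex_derive_n_Derive | exact Hg].
      * do 2 (apply functional_extensionality; intro); symmetry; apply Derive_scal_l.
    + replace (fun u v => Derive (fun z => f u * g z) v) with (fun u v => f u * Derive g v).
      * apply IH; [exact Hf | now apply ex_derive_n_Derive].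
      * do 2 (apply functional_extensionality; intro); symmetry; apply Derive_scal.
Qed.

Section Sufficiency.

Variables (Omega : R -> Prop) (E : ode4) (q : R) (g : R -> R).
Hypothesis HOmega : open Omega.
Hypothesis Hg : forall n y, ex_derive_n g n y.
Hypothesis Hg' : forall y, Omega y -> Derive g y <> 0.
Hypothesis HE : forall (c d : R) (H : nat -> R -> R), tower c d 4 H ->
  (forall s, c < s < d -> Omega (H 0%nat s)) ->
  exists G, tower c d 4 G /\ forall s, c < s < d -> G 0%nat s = g (H 0%nat s) /\
    (E s (H 0%nat s) (H 1%nat s) (H 2%nat s) (H 3%nat s) (H 4%nat s)
     <-> G 4%nat s + 10 * q * G 2%nat s = 0).

(* With [r = theta' / theta] for a solution of [theta'' + q theta = 0], these are
   the equations satisfied by [phi = theta2 / theta], [P = phi'] and [m = theta^-3]: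
   [G'''' + 10 q G'' + 9 q^2 G] is the third symmetric power of [theta'' + q theta],
   so it becomes [u''''] in these variables. *)
Lemma maps_equation_symmetric_power (lo hi : R) (phi P r m b : R -> R) :
  (forall x, lo < x < hi -> is_derive phi x (P x)) ->
  (forall x, lo < x < hi -> is_derive P x (-2 * r x * P x)) ->
  (forall x, lo < x < hi -> is_derive r x (- q - r x ^ 2)) ->
  (forall x, lo < x < hi -> is_derive m x (-3 * r x * m x)) ->
  (forall x, lo < x < hi -> P x <> 0 /\ m x <> 0 /\ b (phi x) = -9 * q ^ 2 / P x ^ 4) ->
  maps_equation (fun p => lo < fst p < hi /\ Omega (snd p)) (fun x _ => phi x)
    (fun x y => m x * g y) E (linear4 (fun _ => 0) b).
Proof.
  intros Dphi DP Dr Dm Hne c d H u HH HU _ Hu z Hz.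
  pose proof (tower_of_ex_derive_n c d 4 H HH) as TH.
  destruct (HE c d (Derive_n H) TH) as (G & TG & HG); [intros s Hs; apply (HU s Hs)|].
  assert (Hin : forall s, c < s < d -> lo < s < hi) by (intros s Hs; apply (HU s Hs)).
  (* The derivatives of [phi] and of [m G] are reduced by the equations for [P], [r] and [m]: they
     are [P], respectively [m], times polynomials in [r], with coefficients that for [m G] involve
     the derivatives of [G]. *)
  pose (Phi := fun k s => match k with
    | 0%nat => phi s | 1%nat => P s | 2%nat => -2 * r s * P s
    | 3%nat => (2 * q + 6 * r s ^ 2) * P s
    | _ => (-16 * q * r s - 24 * r s ^ 3) * P s end).
  pose (Psi := fun k s => match k with
    | 0%nat => m s * G 0%nat s
    | 1%nat => m s * (G 1%nat s - 3 * r s * G 0%nat s)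
    | 2%nat => m s * (G 2%nat s - 6 * r s * G 1%nat s + (3 * q + 12 * r s ^ 2) * G 0%nat s)
    | 3%nat => m s * (G 3%nat s - 9 * r s * G 2%nat s + (9 * q + 36 * r s ^ 2) * G 1%nat s
        - (33 * q * r s + 60 * r s ^ 3) * G 0%nat s)
    | _ => m s * (G 4%nat s - 12 * r s * G 3%nat s + (18 * q + 72 * r s ^ 2) * G 2%nat s
        - (132 * q * r s + 240 * r s ^ 3) * G 1%nat s
        + (33 * q ^ 2 + 312 * q * r s ^ 2 + 360 * r s ^ 4) * G 0%nat s) end).
  assert (XP : forall s, c < s < d -> ex_derive (fun x => P x) s /\ Derive (fun x => P x) s = -2 * r s * P s)
    by (intros s Hs; split; [eexists; apply DP | apply is_derive_unique, DP]; auto).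
  assert (Xr : forall s, c < s < d -> ex_derive (fun x => r x) s /\ Derive (fun x => r x) s = - q - r s ^ 2)
    by (intros s Hs; split; [eexists; apply Dr | apply is_derive_unique, Dr]; auto).
  assert (Xm : forall s, c < s < d -> ex_derive (fun x => m x) s /\ Derive (fun x => m x) s = -3 * r s * m s)
    by (intros s Hs; split; [eexists; apply Dm | apply is_derive_unique, Dm]; auto).
  assert (XG : forall k s, (k < 4)%nat -> c < s < d ->
    ex_derive (fun x => G k x) s /\ Derive (fun x => G k x) s = G (S k) s)
    by (intros k s Hk Hs; split; [eexists; apply TG | apply is_derive_unique, TG]; auto).
  assert (TPhi : tower c d 4 Phi).
  { intros k Hk s Hs; destruct (XP s Hs) as [? EP]; destruct (Xr s Hs) as [? Er].
    destruct k as [|[|[|[|k]]]]; [auto | auto | | | lia]; unfold Phi;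
      (auto_derive; [repeat split; auto | rewrite EP, Er; ring]). }
  assert (TPsi : tower c d 4 Psi).
  { intros k Hk s Hs; destruct (Xm s Hs) as [? Em]; destruct (Xr s Hs) as [? Er].
    destruct (XG 0%nat s) as [? E0]; [lia | exact Hs |].
    destruct (XG 1%nat s) as [? E1]; [lia | exact Hs |].
    destruct (XG 2%nat s) as [? E2]; [lia | exact Hs |].
    destruct (XG 3%nat s) as [? E3]; [lia | exact Hs |].
    destruct k as [|[|[|[|k]]]]; [ | | | | lia]; unfold Psi;
      (auto_derive; [repeat split; auto | rewrite Em, ?Er, ?E0, ?E1, ?E2, ?E3; ring]). }
  destruct (Derive_n_parametric Phi Psi u c d TPhi TPsi) with (s := z) as [D1 D4]; auto.
  { intros s Hs; apply Hne; auto. }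
  { intros s Hs; unfold Phi, Psi; rewrite (proj1 (HG s Hs)); apply Hu, Hs. }
  change (Phi 0%nat z) with (phi z) in D1, D4.
  destruct (HG z Hz) as [HG0 Hequiv].
  change (Derive_n H 0 z) with (H z) in HG0.
  destruct (Hne z (Hin z Hz)) as (HP & Hm & Hb).
  unfold holds_at, linear4; rewrite D4, D1.
  rewrite (Hu z Hz), <- HG0, Hb.
  apply (iff_trans Hequiv).
  (* Here [u''''] equals [m / P ^ 4] times [G'''' + 10 q G'' + 9 q^2 G], and [b] was chosen to
     cancel the last term. *)
  replace (_ + 0 * _ + _) with (m z / P z ^ 4 * (G 4%nat z + 10 * q * G 2%nat z)).
  - assert (Hf : m z / P z ^ 4 <> 0).
    { apply Rmult_integral_contrapositive; split; [exact Hm|].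
      now apply Rinv_neq_0_compat, pow_nonzero. }
    split; [intros ->; ring|].
    intros K; apply Rmult_integral in K; destruct K; [contradiction | assumption].
  - unfold u4, u3, u2, u1, Phi, Psi; field; exact HP.
Qed.

Lemma local_linearization (z0 h0 lo hi : R) (phi P r m b : R -> R) :
  lo < z0 < hi -> Omega h0 ->
  (forall n, derivable_upto lo hi n phi) -> (forall n, derivable_upto lo hi n m) ->
  (forall x, lo < x < hi -> is_derive phi x (P x)) ->
  (forall x, lo < x < hi -> is_derive P x (-2 * r x * P x)) ->
  (forall x, lo < x < hi -> is_derive r x (- q - r x ^ 2)) ->
  (forall x, lo < x < hi -> is_derive m x (-3 * r x * m x)) ->
  (forall x, lo < x < hi -> P x <> 0 /\ m x <> 0 /\ b (phi x) = -9 * q ^ 2 / P x ^ 4) ->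
  exists (U : R * R -> Prop) (phi psi : R -> R -> R) (a b : R -> R),
    open U /\ U (z0, h0) /\ (forall p, U p -> Omega (snd p)) /\
    point_transformation U phi psi /\ maps_equation U phi psi E (linear4 a b).
Proof.
  intros Hz0 Hh0 Sphi Sm Dphi DP Dr Dm Hne.
  exists (fun p => lo < fst p < hi /\ Omega (snd p)), (fun x _ => phi x), (fun x y => m x * g y),
    (fun _ => 0), b.
  split; [|split; [|split; [|split]]].
  - apply open_and.
    + apply (open_comp fst (fun x => lo < x < hi)).
      * intros x _; apply continuous_fst.
      * apply open_and; [apply open_gt | apply open_lt].
    + apply (open_comp snd Omega); [intros x _; apply continuous_snd | exact HOmega].
  - split; [exact Hz0 | exact Hh0].
  - intros p Hp; apply Hp.
  - split; [|split].
    + intros x y [Hx _] n; simpl in Hx.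
      replace (fun x _ => phi x) with (fun x (y : R) => phi x * (fun _ => 1) y)
        by (do 2 (apply functional_extensionality; intro); ring).
      apply ex_diff_n_tensor; intros k; [|apply ex_derive_n_const].
      now apply (derivable_upto_ex_derive_n lo hi).
    + intros x y [Hx _] n; simpl in Hx.
      apply ex_diff_n_tensor; intros k; [|apply Hg].
      now apply (derivable_upto_ex_derive_n lo hi).
    + intros x y [Hx Hy]; simpl in Hx, Hy; unfold jacobian.
      rewrite Derive_const, (Derive_scal g).
      change (Derive (fun s => phi s) x) with (Derive phi x); rewrite (is_derive_unique _ _ _ (Dphi x Hx)).
      destruct (Hne x Hx) as (HP & Hm & _); rewrite Rmult_0_l, Rminus_0_r.
      repeat (apply Rmult_integral_contrapositive; split); auto.
  - apply (maps_equation_symmetric_power lo hi phi P r m b); assumption.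
Qed.

Lemma linearizable_symmetric_power : linearizable (fun p => Omega (snd p)) E.
Proof.
  intros [z0 h0] Hh0; simpl in Hh0.
  destruct (Rtotal_order q 0) as [Hq|[Hq|Hq]].
  (* For [q = - w ^ 2]: [theta = exp (- w x)] and [theta2 = exp (w x)]. *)
  - set (w := sqrt (- q)).
    assert (Hw : 0 < w) by (apply sqrt_lt_R0; lra).
    assert (Hw2 : q = - w ^ 2) by (unfold w; rewrite pow2_sqrt; lra).
    apply (local_linearization z0 h0 (z0 - 1) (z0 + 1) (fun x => exp (2 * w * x))
      (fun x => 2 * w * exp (2 * w * x)) (fun _ => - w) (fun x => exp (3 * w * x))
      (fun t => -9 / (16 * t ^ 4))); auto; try lra.
    + intros n; apply derivable_upto_exp.
    + intros n; apply derivable_upto_exp.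
    + intros x _; auto_derive; [exact I | ring].
    + intros x _; auto_derive; [exact I | ring].
    + intros x _; rewrite Hw2; auto_derive; [exact I | ring].
    + intros x _; auto_derive; [exact I | ring].
    + intros x _; pose proof (exp_pos (2 * w * x)); pose proof (exp_pos (3 * w * x)).
      repeat split; [nra | lra |]; rewrite Hw2; field; split; lra.
  (* For [q = 0]: [theta = 1] and [theta2 = x]. *)
  - apply (local_linearization z0 h0 (z0 - 1) (z0 + 1) (fun x => x) (fun _ => 1) (fun _ => 0)
      (fun _ => 1) (fun _ => 0)); auto; try lra; rewrite ?Hq.
    + intros n; apply derivable_upto_id.
    + intros n; apply derivable_upto_const.
    + intros x _; auto_derive; [exact I | ring].
    + intros x _; auto_derive; [exact I | ring].
    + intros x _; auto_derive; [exact I | ring].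
    + intros x _; auto_derive; [exact I | ring].
    + intros x _; repeat split; [lra | lra | field].
  (* For [q = w ^ 2]: [theta] and [theta2] are the cosine and sine of [w (x - z0)]. The radius [/ w]
     keeps this angle within (-1, 1), where the cosine is positive. *)
  - set (w := sqrt q).
    assert (Hw : 0 < w) by (apply sqrt_lt_R0; lra).
    assert (Hw2 : q = w ^ 2) by (unfold w; rewrite pow2_sqrt; lra).
    set (e := / w).
    assert (He : 0 < e) by (apply Rinv_0_lt_compat, Hw).
    assert (Hcos : forall x, z0 - e < x < z0 + e -> 0 < cos (w * (x - z0))).
    { intros x Hx; assert (-1 < w * (x - z0) < 1).
      { assert (w * e = 1) by (unfold e; field; lra). nra. }
      pose proof PI2_1; apply cos_gt_0; lra. }
    assert (Hsc : forall y, sin y ^ 2 = 1 - cos y ^ 2).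
    { intros y; pose proof (sin2_cos2 y); unfold Rsqr in *; lra. }
    apply (local_linearization z0 h0 (z0 - e) (z0 + e)
      (fun x => sin (w * (x - z0)) * / cos (w * (x - z0)))
      (fun x => w / cos (w * (x - z0)) ^ 2)
      (fun x => - w * (sin (w * (x - z0)) / cos (w * (x - z0))))
      (fun x => / cos (w * (x - z0)) * (/ cos (w * (x - z0)) * / cos (w * (x - z0))))
      (fun t => -9 / (1 + t ^ 2) ^ 4)); auto; try lra.
    + intros n; destruct (derivable_upto_sin_cos (z0 - e) (z0 + e) w z0 n) as [S C].
      apply derivable_upto_mult; [exact S|]; apply derivable_upto_inv; [|exact C].
      intros x Hx; specialize (Hcos x Hx); lra.
    + intros n; destruct (derivable_upto_sin_cos (z0 - e) (z0 + e) w z0 n) as [S C].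
      apply derivable_upto_inv in C; [|intros x Hx; specialize (Hcos x Hx); lra].
      repeat apply derivable_upto_mult; exact C.
    + intros x Hx; specialize (Hcos x Hx); auto_derive; [unfold Rminus in Hcos; repeat split; lra|].
      unfold Rminus in *; specialize (Hsc (w * (x - z0))).
      set (C := cos _) in *; set (S := sin _) in *.
      transitivity (w * (C ^ 2 + S ^ 2) / C ^ 2); [field; lra|]. rewrite Hsc; field; lra.
    + intros x Hx; specialize (Hcos x Hx); auto_derive; [unfold Rminus in Hcos; repeat split; nra|].
      unfold Rminus in *; field; lra.
    + intros x Hx; specialize (Hcos x Hx); rewrite Hw2;
        auto_derive; [unfold Rminus in Hcos; repeat split; lra|].
      unfold Rminus in *; field; lra.
    + intros x Hx; specialize (Hcos x Hx); auto_derive; [unfold Rminus in Hcos; repeat split; lra|].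
      unfold Rminus in *; field; lra.
    + intros x Hx; specialize (Hcos x Hx); rewrite Hw2; specialize (Hsc (w * (x - z0))).
      set (C := cos _) in *; set (S := sin _) in *.
      assert (HC : 0 < C ^ 2) by nra.
      repeat split.
      * apply Rmult_integral_contrapositive; split; [lra | apply Rinv_neq_0_compat; lra].
      * repeat (apply Rmult_integral_contrapositive; split); apply Rinv_neq_0_compat; lra.
      * replace (1 + (S * / C) ^ 2) with (/ C ^ 2).
        -- field; lra.
        -- transitivity ((C ^ 2 + S ^ 2) / C ^ 2); [rewrite Hsc|]; field; lra.
Qed.

End Sufficiency.

(** * Application to the profile equation *)

Lemma open_profile_region (mu nu D : R) : open (fun y => nu * y + mu * D ^ 2 <> 0).
Proof.
  apply (open_comp (fun y => nu * y + mu * D ^ 2) (fun w => w <> 0)); [|apply open_neq].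
  intros y _; apply (ex_derive_continuous (fun y => nu * y + mu * D ^ 2)).
  auto_derive; exact I.
Qed.

(** With [G = H] the equation is [W (G'''' + 10 q G'') = 0]. This serves both [nu = 0], where [W] is
    constant, and [kappa = D ^ 2], where [q = 0]. *)
Lemma linearizable_constant_ratio (alpha beta gamma mu nu kappa D q : R) :
  alpha = 0 -> beta = 0 -> gamma = 0 ->
  (forall y, nu * y + mu * D ^ 2 <> 0 -> kappa - D ^ 2 = 10 * q * (nu * y + mu * D ^ 2)) ->
  linearizable (profile_region mu nu D) (profile_equation alpha beta gamma mu nu kappa D).
Proof.
  intros -> -> -> Hq.
  apply (linearizable_symmetric_power (fun y => nu * y + mu * D ^ 2 <> 0) _ q (fun y => y)).
  - apply open_profile_region.
  - intros n y; apply (derivable_upto_ex_derive_n (y - 1) (y + 1)); [|lra].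
    intros k; apply derivable_upto_id.
  - intros y _; rewrite Derive_id; lra.
  - intros c d H HT HW; exists H; split; [exact HT|].
    intros s Hs; split; [reflexivity|]; unfold profile_equation.
    specialize (HW s Hs); specialize (Hq _ HW).
    set (W := nu * H 0%nat s + mu * D ^ 2) in *.
    replace (_ + _) with (W * (H 4%nat s + 10 * q * H 2%nat s)).
    + split; [|intros ->; ring].
      intros K; apply Rmult_integral in K; destruct K; [contradiction | assumption].
    + replace kappa with (D ^ 2 + 10 * q * W) by lra; ring.
Qed.

(** The second hypothesis says [m = (2 gamma / nu) W]. With [G = W ^ 2] and [10 q = 2 gamma / nu],
    the expression [G'''' + 10 q G''] is [2 nu] times the left-hand side of the profile equation. *)
Lemma linearizable_square (gamma mu nu kappa D : R) :
  nu <> 0 -> 2 * gamma * (mu * D ^ 2) = nu * (kappa - D ^ 2) ->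
  linearizable (profile_region mu nu D)
    (profile_equation (4 * nu) (3 * nu) gamma mu nu kappa D).
Proof.
  intros Hnu Hk.
  apply (linearizable_symmetric_power (fun y => nu * y + mu * D ^ 2 <> 0) _ (gamma / (5 * nu))
    (fun y => (nu * y + mu * D ^ 2) * (nu * y + mu * D ^ 2))).
  - apply open_profile_region.
  - intros n y; apply (derivable_upto_ex_derive_n (y - 1) (y + 1)); [|lra].
    intros k; apply derivable_upto_mult; apply derivable_upto_plus;
      try apply derivable_upto_const; apply derivable_upto_mult;
      (apply derivable_upto_const || apply derivable_upto_id).
  - intros y HW; rewrite (is_derive_unique _ y (2 * nu * (nu * y + mu * D ^ 2))).
    + repeat (apply Rmult_integral_contrapositive; split); auto; lra.
    + auto_derive; [exact I | ring].
  - intros c d H HT HW.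
    pose (W := fun s => nu * H 0%nat s + mu * D ^ 2).
    exists (fun k s => match k with
      | 0%nat => W s * W s
      | 1%nat => 2 * nu * W s * H 1%nat s
      | 2%nat => 2 * nu * (nu * H 1%nat s ^ 2 + W s * H 2%nat s)
      | 3%nat => 2 * nu * (3 * nu * H 1%nat s * H 2%nat s + W s * H 3%nat s)
      | _ => 2 * nu * (3 * nu * H 2%nat s ^ 2 + 4 * nu * H 1%nat s * H 3%nat s + W s * H 4%nat s)
      end).
    split.
    + intros k Hk' s Hs; unfold W.
      assert (XH : forall i, (i < 4)%nat ->
        ex_derive (fun x => H i x) s /\ Derive (fun x => H i x) s = H (S i) s)
        by (intros i Hi; split; [eexists; apply HT | apply is_derive_unique, HT]; auto).
      destruct (XH 0%nat) as [? E0]; [lia|]; destruct (XH 1%nat) as [? E1]; [lia|].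
      destruct (XH 2%nat) as [? E2]; [lia|]; destruct (XH 3%nat) as [? E3]; [lia|].
      destruct k as [|[|[|[|k]]]]; [ | | | | lia];
        (auto_derive; [repeat split; auto | rewrite ?E0, ?E1, ?E2, ?E3; ring]).
    + intros s Hs; split; [reflexivity|]; unfold profile_equation.
      specialize (HW s Hs); fold (W s) in HW |- *.
      assert (EW : 2 * gamma * H 0%nat s + kappa - D ^ 2 = 2 * gamma / nu * W s).
      { apply Rmult_eq_reg_l with nu; [|exact Hnu].
        transitivity (2 * gamma * W s); [unfold W; lra | field; exact Hnu]. }
      rewrite EW.
      assert (EG : forall x y, x = 2 * nu * y -> (y = 0 <-> x = 0)).
      { intros x y ->; split; [intros ->; ring|].
        intros K; apply Rmult_integral in K; destruct K; [lra | assumption]. }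
      apply EG; field; exact Hnu.
Qed.

Lemma profile_region_nonempty (mu nu D : R) :
  ~ (nu = 0 /\ mu * D ^ 2 = 0) -> exists h, profile_region mu nu D (0, h).
Proof.
  intros Hn; unfold profile_region; simpl snd.
  destruct (Req_dec (mu * D ^ 2) 0) as [E|E].
  - exists 1; intros K; apply Hn; lra.
  - exists 0; lra.
Qed.

(** A linearization near a single point already forces the relations, because they involve only the
    constants; nondegeneracy supplies such a point. *)
Lemma linearizable_necessary (alpha beta gamma mu nu kappa D : R) :
  ~ (nu = 0 /\ mu * D ^ 2 = 0) ->
  linearizable (profile_region mu nu D) (profile_equation alpha beta gamma mu nu kappa D) ->
  alpha * (alpha - 4 * nu) = 0 /\ 3 * alpha = 4 * beta /\
  2 * gamma * (mu * D ^ 2) = nu * (kappa - D ^ 2) /\ gamma * (alpha - 4 * nu) = 0.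
Proof.
  intros Hn HL; destruct (profile_region_nonempty mu nu D Hn) as [h Hh].
  destruct (HL _ Hh) as (U & phi & psi & a & b & HU & HUp & HUR & Hpt & Hmap).
  exact (necessary_conditions alpha beta gamma mu nu kappa D U phi psi a b HU HUR Hpt Hmap 0 h HUp).
Qed.

Theorem mainTheorem1 :
  forall alpha beta gamma mu nu kappa D : R,
    ~ (nu = 0 /\ mu * D ^ 2 = 0) ->
    (nu = 0 ->
       (linearizable (profile_region mu nu D)
          (profile_equation alpha beta gamma mu nu kappa D)
        <-> alpha = 0 /\ beta = 0 /\ gamma = 0))
    /\
    (nu <> 0 -> gamma = 0 -> beta = 0 ->
       (linearizable (profile_region mu nu D)
          (profile_equation alpha beta gamma mu nu kappa D)
        <-> alpha = 0 /\ kappa = D ^ 2))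
    /\
    (nu <> 0 -> gamma = 0 -> beta = 3 * nu ->
       (linearizable (profile_region mu nu D)
          (profile_equation alpha beta gamma mu nu kappa D)
        <-> alpha = 4 * nu /\ kappa = D ^ 2))
    /\
    (nu <> 0 -> gamma <> 0 ->
       (linearizable (profile_region mu nu D)
          (profile_equation alpha beta gamma mu nu kappa D)
        <-> alpha = 4 * nu /\ beta = 3 * nu /\
            kappa = (2 * gamma * mu + nu) * D ^ 2 / nu)).
Proof.
  intros alpha beta gamma mu nu kappa D Hn.
  pose proof (linearizable_necessary alpha beta gamma mu nu kappa D Hn) as HL.
  repeat split.
  1-3: assert (HM : mu * D ^ 2 <> 0) by (intros E; apply Hn; auto).
  - destruct (HL H0) as (H1 & _); subst nu; apply Rmult_integral in H1; lra.
  - destruct (HL H0) as (H1 & H2 & _); subst nu; apply Rmult_integral in H1; lra.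
  - destruct (HL H0) as (_ & _ & H3 & _); subst nu.
    apply Rmult_eq_reg_r with (mu * D ^ 2); [lra | exact HM].
  - intros (Ha & Hb & Hg).
    assert (HM : mu * D ^ 2 <> 0) by (intros E; apply Hn; auto).
    (* For [nu = 0] the factor [W] is the constant [mu * D ^ 2], and [q] is solved from
       [kappa - D ^ 2 = 10 q W]. *)
    apply (linearizable_constant_ratio _ _ _ _ _ _ _ ((kappa - D ^ 2) / (10 * (mu * D ^ 2))) Ha Hb Hg).
    intros y _; rewrite H, Rmult_0_l, Rplus_0_l; field; split; intros E; apply HM; rewrite E; ring.
  - destruct (HL H2) as (_ & E & _); lra.
  - destruct (HL H2) as (_ & _ & E & _); subst gamma.
    apply Rmult_eq_reg_l with nu; lra.
  - intros [Ha Hk].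
    apply (linearizable_constant_ratio _ _ _ _ _ _ _ 0 Ha H1 H0).
    intros y _; lra.
  - destruct (HL H2) as (_ & E & _); lra.
  - destruct (HL H2) as (_ & _ & E & _); subst gamma.
    apply Rmult_eq_reg_l with nu; lra.
  - intros [-> Hk]; rewrite H1; apply linearizable_square; [exact H|].
    rewrite H0, Hk; ring.
  (* As [gamma] is nonzero, [gamma * (alpha - 4 * nu) = 0] fixes [alpha]. *)
  - destruct (HL H1) as (_ & _ & _ & E); apply Rmult_integral in E; lra.
  - destruct (HL H1) as (_ & E' & _ & E); apply Rmult_integral in E; lra.
  - destruct (HL H1) as (_ & _ & E & _).
    apply Rmult_eq_reg_l with nu; [|exact H].
    transitivity ((2 * gamma * mu + nu) * D ^ 2); [lra | field; exact H].
  - intros (-> & -> & ->); apply linearizable_square; [exact H | field; exact H].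
Qed.
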